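(* Let $T>0$ and $\mu\geqslant 0$. Let $\varphi:\mathbb{R}\to\mathbb{R}$ be a $C^\infty$-smooth $T$-periodic function with zero average value, $\int_0^T\varphi(s)\,ds=0$, and let $h:\mathbb{R}^3\to\mathbb{R}$, $(q,p,t)\mapsto h(q,p,t)$, be a bounded $C^\infty$-smooth function that is $T$-periodic in $t$. Let $\Phi=\frac1T\int_0^T\varphi^2(s)\,ds$, and suppose that $\Phi>1$. Put $$f(q)=-\sin q-\frac{\Phi}{2}\sin 2q,\qquad \lambda_2=\frac{-1-\sqrt{1+8\Phi^2}}{4\Phi},\qquad q_{max}^2=\arccos(\lambda_2),\qquad q_{min}^2=2\pi-\arccos(\lambda_2).$$ Suppose that for all $t\in\mathbb{R}$ $$h(\pi/2,0,t)<1,\quad h(3\pi/2,0,t)>-1,\quad h(q_{max}^2,0,t)>-f(q_{max}^2),\quad h(q_{min}^2,0,t)<-f(q_{min}^2).$$ Then there exists $K$ such that for any $k\in\mathbb{N}$, $k>K$, the system $$\dot q=p-\varphi(kt)\sin q,$$ $$\dot p=-\mu p+[\mu\sin q+p\cos q]\,\varphi(kt)-\sin q-\frac{\varphi^2(kt)}{2}\sin 2q+h(q,p,t)$$ has two $T$-periodic solutions, with $q$-components $q_1(t)$ and $q_2(t)$, satisfying $q_1(t)\in(\pi/2,q_{max}^2)$ and $q_2(t)\in(q_{min}^2,3\pi/2)$ for all $t$.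
   Context: A dot denotes the derivative with respect to $t$. A $T$-periodic solution is a solution $(q,p):\mathbb{R}\to\mathbb{R}^2$ defined for all $t$ with $q(t+T)=q(t)$ and $p(t+T)=p(t)$ for all $t$ (here $q$ is real-valued, not taken modulo $2\pi$). The superscript $2$ in $q_{max}^2$ and $q_{min}^2$ is an index, not a power. The function $\arccos$ takes values in $[0,\pi]$; for $\Phi>1$ one has $\lambda_2\in(-1,0)$, so $q_{max}^2\in(\pi/2,\pi)$ and $q_{min}^2\in(\pi,3\pi/2)$. *)

(* Defs.v *)
From Stdlib Require Import Reals.
From Coquelicot Require Import Coquelicot.
Open Scope R_scope.

Definition periodic (T : R) (x : R -> R) : Prop := forall t, x (t + T) = x t.

Definition smooth1 (f : R -> R) : Prop := forall n x, ex_derive_n f n x.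

Definition continuous3 (h : R -> R -> R -> R) : Prop :=
  forall x : R * R * R,
    continuous (fun y : R * R * R => h (fst (fst y)) (snd (fst y)) (snd y)) x.

(* [Derive] is total, so [Ck3] asserts existence of the partial derivatives
   separately; continuity is joint in the three variables. *)
Definition D1 (h : R -> R -> R -> R) : R -> R -> R -> R :=
  fun x y z => Derive (fun u => h u y z) x.
Definition D2 (h : R -> R -> R -> R) : R -> R -> R -> R :=
  fun x y z => Derive (fun u => h x u z) y.
Definition D3 (h : R -> R -> R -> R) : R -> R -> R -> R :=
  fun x y z => Derive (fun u => h x y u) z.

Fixpoint Ck3 (n : nat) (h : R -> R -> R -> R) : Prop :=
  continuous3 h /\
  match n with
  | O => True
  | S m =>
      (forall x y z,
         ex_derive (fun u => h u y z) x /\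
         ex_derive (fun u => h x u z) y /\
         ex_derive (fun u => h x y u) z) /\
      Ck3 m (D1 h) /\ Ck3 m (D2 h) /\ Ck3 m (D3 h)
  end.

Definition smooth3 (h : R -> R -> R -> R) : Prop := forall n, Ck3 n h.

Definition bounded3 (h : R -> R -> R -> R) : Prop :=
  exists M, forall x y z, Rabs (h x y z) <= M.

Definition mean_square (T : R) (phi : R -> R) : R :=
  / T * RInt (fun s => phi s ^ 2) 0 T.

Definition f_avg (Phi q : R) : R := - sin q - Phi / 2 * sin (2 * q).

Definition lambda2 (Phi : R) : R := (-1 - sqrt (1 + 8 * Phi ^ 2)) / (4 * Phi).

(* The trailing 2 in [qmax2] and [qmin2] is an index, not a power. *)
Definition qmax2 (Phi : R) : R := acos (lambda2 Phi).
Definition qmin2 (Phi : R) : R := 2 * PI - acos (lambda2 Phi).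

Definition is_solution (mu : R) (phi : R -> R) (h : R -> R -> R -> R) (k : nat)
    (q p : R -> R) : Prop :=
  forall t : R,
    is_derive q t (p t - phi (INR k * t) * sin (q t)) /\
    is_derive p t
      (- mu * p t
       + (mu * sin (q t) + p t * cos (q t)) * phi (INR k * t)
       - sin (q t)
       - phi (INR k * t) ^ 2 / 2 * sin (2 * q t)
       + h (q t) (p t) t).

Definition is_periodic_solution (T mu : R) (phi : R -> R)
    (h : R -> R -> R -> R) (k : nat) (q p : R -> R) : Prop :=
  is_solution mu phi h k q p /\ periodic T q /\ periodic T p.

(* Main.v *)
Require Import Defs.
From Stdlib Require Import Reals Lra Lia Psatz ZArith Classical IndefiniteDescription.
From Coquelicot Require Import Coquelicot.
From mathcomp Require filter.
Open Scope R_scope.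

(** With [v = p - phi (k t) sin q] the system becomes the second order equation
      [q'' + mu q' = - sin q (1 + k phi' (k t)) + h (q, q' + phi (k t) sin q, t)],
    in which [phi ^ 2] no longer occurs.  Fix [k].  Such an equation has a
    periodic solution between any two periodic functions [al <= be] satisfying
    the strict inequalities of a lower solution,
    [al'' + mu al' > right-hand side], and of an upper solution
    ([periodic_solution_between]).  So it is enough to have a lower solution
    slightly to the right of the left end of the interval and an upper solution
    slightly to the left of its right end.

    The averaged force enters through these two functions.  Near a constant [a]
    take the periodic function
      [a - Psi (k t) sin a / k + chi (k t) / k ^ 2], with [Psi' = phi].
    Its second derivative cancels the term [k phi' sin a], and the next order
    leaves [phi' Psi sin a cos a], whose mean is [- Phi sin a cos a] because
    [phi' Psi] and [- phi ^ 2] have the same integral over a period.  The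
    corrector [chi] absorbs the oscillating rest, so that the function solves
    the equation without [h] up to the constant [- f_avg Phi a] and an error of
    order [1/k]
    ([barrier_exists]).  It is therefore a strict lower solution for large [k]
    when [f_avg Phi a + h a 0 t < 0] for all [t], and a strict upper solution
    when this quantity is positive: exactly the signs assumed at the ends of
    the two intervals, since [f_avg] is [-1] at [PI / 2] and [1] at
    [3 PI / 2].

    Existence between lower and upper solutions rests on order and compactness.
    Replacing derivatives by difference quotients with a small step
    [tau] dividing [T] makes the equation a fixed point equation of a map that
    is monotone on functions ([relax_monotone]), so the supremum of its
    subsolutions solves it ([scheme_solution_exists]).  Velocities, and the
    remainders of the first order Taylor expansions of the solution and of its
    velocity along the grid, are bounded uniformly in [tau]; hence limits along
    a free ultrafilter, taken pointwise as [tau] tends to 0, are differentiable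
    and satisfy the equation.  The velocity bound involves [h] only through its
    supremum, which allows the momentum argument of [h] to be clamped
    beforehand, so that the force is Lipschitz. *)

(** * Limits along a free ultrafilter *)

Definition ultra (U : (nat -> Prop) -> Prop) : Prop :=
  forall P, U P \/ U (fun n => ~ P n).

Lemma free_ultrafilter_exists :
  exists U : (nat -> Prop) -> Prop,
    ProperFilter U /\ ultra U /\ (forall P, eventually P -> U P).
Proof.
  assert (HF : @filter.ProperFilter nat eventually).
  { constructor.
    - intros [n Hn]. exact (Hn n (le_n n)).
    - constructor.
      + now exists 0%nat.
      + intros P Q [n Hn] [m Hm]. exists (n + m)%nat. intros k Hk.
        split; [apply Hn | apply Hm]; lia.
      + intros P Q HPQ [n Hn]. exists n. intros k Hk. apply HPQ, Hn, Hk. }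
  destruct (filter.ultraFilterLemma HF) as [U [HU Hev]].
  assert (HP := @filter.ultra_proper _ _ HU).
  assert (HFU := @filter.filter_filter _ _ HP).
  exists U. split; [split | split].
  - intros P HPU. apply NNPP. intros Hno.
    apply (@filter.filter_not_empty _ _ HP).
    apply (@filter.filterS _ _ HFU P); [|exact HPU].
    intros n Hn. apply Hno. now exists n.
  - constructor.
    + apply (@filter.filterT _ _ HFU).
    + intros P Q H1 H2. apply (@filter.filterI _ _ HFU P Q H1 H2).
    + intros P Q HPQ. apply (@filter.filterS _ _ HFU P Q HPQ).
  - intros P. exact (filter.in_ultra_setVsetC P HU).
  - intros P HP0. exact (Hev P HP0).
Qed.

(** The limit is the supremum of the levels that the sequence exceeds on a
    set of the ultrafilter. *)
Lemma ultra_bounded_lim (U : (nat -> Prop) -> Prop) (FU : ProperFilter U)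
  (HU : ultra U) (x : nat -> R) (a b : R) :
  (forall n, a <= x n <= b) -> exists l : R, filterlim x U (locally l).
Proof.
  intros Hx.
  destruct (completeness (fun r => U (fun n => r <= x n))) as [l [Hub Hlub]].
  - exists b. intros r Hr. destruct (filter_ex _ Hr) as [n Hn].
    specialize (Hx n). lra.
  - exists a. apply filter_imp with (fun _ => True).
    + intros n _. apply Hx.
    + apply filter_true.
  - exists l. apply filterlim_locally. intros eps.
    assert (He := cond_pos eps).
    assert (H1 : U (fun n => x n < l + eps)).
    { destruct (HU (fun n => l + eps / 2 <= x n)) as [H|H].
      - specialize (Hub _ H). lra.
      - revert H. apply filter_imp. intros n Hn. lra. }
    assert (H2 : U (fun n => l - eps < x n)).
    { destruct (HU (fun n => l - eps / 2 <= x n)) as [H|H].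
      - revert H. apply filter_imp. intros n Hn. lra.
      - exfalso. assert (l <= l - eps / 2); [|lra]. apply Hlub.
        intros r Hr. destruct (filter_ex _ (filter_and _ _ Hr H)) as [n Hn]. lra. }
    generalize (filter_and _ _ H1 H2). apply filter_imp. intros n Hn.
    change (Rabs (x n - l) < eps). apply Rabs_def1; lra.
Qed.

Lemma filterlim_Rle {U : (nat -> Prop) -> Prop} (FU : ProperFilter U)
  (x y : nat -> R) (lx ly : R) :
  (forall n, x n <= y n) -> filterlim x U (locally lx) ->
  filterlim y U (locally ly) -> lx <= ly.
Proof.
  intros Hxy Hx Hy.
  apply (@filterlim_le _ U _ x y (Finite lx) (Finite ly)); trivial.
  apply filter_imp with (fun _ => True); [intros n _; apply Hxy | apply filter_true].
Qed.

Lemma filterlim_Rplus {U : (nat -> Prop) -> Prop} (FU : ProperFilter U)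
  (x y : nat -> R) (lx ly : R) :
  filterlim x U (locally lx) -> filterlim y U (locally ly) ->
  filterlim (fun n => x n + y n) U (locally (lx + ly)).
Proof.
  intros Hx Hy. eapply filterlim_comp_2; [exact Hx | exact Hy |].
  apply (filterlim_plus lx ly).
Qed.

Lemma filterlim_Rmult {U : (nat -> Prop) -> Prop} (FU : ProperFilter U)
  (x y : nat -> R) (lx ly : R) :
  filterlim x U (locally lx) -> filterlim y U (locally ly) ->
  filterlim (fun n => x n * y n) U (locally (lx * ly)).
Proof.
  intros Hx Hy. eapply filterlim_comp_2; [exact Hx | exact Hy |].
  apply (filterlim_mult lx ly).
Qed.

Lemma filterlim_Rminus {U : (nat -> Prop) -> Prop} (FU : ProperFilter U)
  (x y : nat -> R) (lx ly : R) :
  filterlim x U (locally lx) -> filterlim y U (locally ly) ->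
  filterlim (fun n => x n - y n) U (locally (lx - ly)).
Proof.
  intros Hx Hy. apply filterlim_Rplus; trivial.
  eapply filterlim_comp; [exact Hy | apply (filterlim_opp ly)].
Qed.

Lemma filterlim_Rabs_comp {U : (nat -> Prop) -> Prop} (FU : ProperFilter U)
  (x : nat -> R) (lx : R) :
  filterlim x U (locally lx) ->
  filterlim (fun n => Rabs (x n)) U (locally (Rabs lx)).
Proof.
  intros Hx. eapply filterlim_comp; [exact Hx | apply (continuous_Rabs lx)].
Qed.

Lemma filterlim_of_bound {U : (nat -> Prop) -> Prop} (FU : ProperFilter U)
  (x y : nat -> R) (l : R) :
  (forall n, Rabs (x n - l) <= y n) -> filterlim y U (locally 0) ->
  filterlim x U (locally l).
Proof.
  intros Hxy Hy. apply filterlim_locally. intros eps.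
  generalize (proj1 (filterlim_locally y 0) Hy eps). apply filter_imp.
  intros n Hn. change (Rabs (y n - 0) < eps) in Hn.
  change (Rabs (x n - l) < eps).
  rewrite Rminus_0_r in Hn. specialize (Hxy n).
  assert (H := Rle_abs (y n)). lra.
Qed.

(** * The monotone difference scheme *)

Section Scheme.

Context (T mu C L lo hi tau : R) (N : nat) (B : R -> R -> R -> R)
  (al be : R -> R).
Context (tau_pos : 0 < tau) (tau_le1 : tau <= 1) (N_pos : (0 < N)%nat)
  (T_eq : T = INR N * tau) (mu_nonneg : 0 <= mu) (L_nonneg : 0 <= L)
  (tau_small : tau * (L + mu) <= 1).
Context (B_bound : forall t u v, Rabs (B t u v) <= C).
Context (B_lip : forall t u v t' u' v', lo <= u <= hi -> lo <= u' <= hi ->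
  Rabs (B t u v - B t' u' v')
  <= L * (Rabs (t - t') + Rabs (u - u') + Rabs (v - v'))).
Context (B_per : forall u v, periodic T (fun t => B t u v)).
Context (al_per : periodic T al) (be_per : periodic T be)
  (al_ge : forall t, lo <= al t) (al_le_be : forall t, al t <= be t)
  (be_le : forall t, be t <= hi).

Definition force (t u v : R) : R := - mu * v + B t u v.

Definition slope (u : R -> R) (t : R) : R := (u (t + tau) - u t) / tau.

Definition defect (u : R -> R) (t : R) : R :=
  u (t + tau) - 2 * u t + u (t - tau) - tau ^ 2 * force t (u t) (slope u t).

Context (al_lower : forall t, 0 <= defect al t)
  (be_upper : forall t, defect be t <= 0).

Definition relax (u : R -> R) (t : R) : R := u t + / 4 * defect u t.

(** The difference quotient decreases when [u t] grows, and the force depends on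
    it with Lipschitz constant [L + mu]; as [tau * (L + mu) <= 1], the loss
    is compensated by the terms [/ 4 * u (t + tau)] and [/ 2 * u t] of [relax].
    The factor [/ 4] is what leaves a positive multiple of [u t]. *)
Lemma relax_monotone (u w : R -> R) :
  (forall t, lo <= u t) -> (forall t, u t <= w t) -> (forall t, w t <= hi) ->
  forall t, relax u t <= relax w t.
Proof.
  intros Hu Huw Hw t. unfold relax, defect, force.
  assert (Ht := Huw t). assert (Htp := Huw (t + tau)).
  assert (Htm := Huw (t - tau)).
  assert (HB := B_lip t (w t) (slope w t) t (u t) (slope u t)
    (conj (Rle_trans _ _ _ (Hu t) Ht) (Hw t))
    (conj (Hu t) (Rle_trans _ _ _ Ht (Hw t)))).
  rewrite Rminus_diag, Rabs_R0, Rplus_0_l in HB.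
  rewrite (Rabs_pos_eq (w t - u t)) in HB by lra.
  set (d0 := w t - u t) in *. set (dp := w (t + tau) - u (t + tau)).
  assert (Hd0 : 0 <= d0) by (unfold d0; lra).
  assert (Hdp : 0 <= dp) by (unfold dp; lra).
  assert (Hs : slope w t - slope u t = (dp - d0) / tau)
    by (unfold slope, dp, d0; field; lra).
  assert (Hsa : Rabs (slope w t - slope u t) <= (dp + d0) / tau).
  { rewrite Hs. unfold Rdiv. rewrite Rabs_mult, (Rabs_pos_eq (/ tau))
      by (left; now apply Rinv_0_lt_compat).
    apply Rmult_le_compat_r; [left; now apply Rinv_0_lt_compat|].
    apply Rabs_le; lra. }
  assert (HB2 : B t (w t) (slope w t) - B t (u t) (slope u t)
    <= L * (d0 + (dp + d0) / tau)).
  { apply Rle_trans with (1 := Rle_abs _). apply Rle_trans with (1 := HB).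
    apply Rmult_le_compat_l; lra. }
  assert (Hv : - mu * (slope w t - slope u t) <= mu * ((dp + d0) / tau)).
  { replace (- mu * (slope w t - slope u t))
      with (mu * (- (slope w t - slope u t))) by ring.
    apply Rmult_le_compat_l; trivial.
    apply Rle_trans with (2 := Hsa). rewrite <- Rabs_Ropp. apply Rle_abs. }
  assert (Hf : tau ^ 2 * ((- mu * slope w t + B t (w t) (slope w t))
     - (- mu * slope u t + B t (u t) (slope u t)))
    <= tau * (tau * L) * d0 + tau * (L + mu) * (dp + d0)).
  { apply Rle_trans with
      (tau ^ 2 * (L * (d0 + (dp + d0) / tau) + mu * ((dp + d0) / tau))).
    - apply Rmult_le_compat_l; [nra | lra].
    - right. field. lra. }
  assert (H1 : tau * (tau * L) <= 1) by nra.
  assert (H2 : tau * (tau * L) * d0 <= d0) by nra.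
  assert (H3 : tau * (L + mu) * (dp + d0) <= dp + d0) by nra.
  unfold d0, dp in *. lra.
Qed.

Definition subsolution (w : R -> R) : Prop :=
  (forall t, al t <= w t <= be t) /\ (forall t, w t <= relax w t).

Lemma defect_periodic_shift (w : R -> R) (t : R) :
  defect (fun s => w (s + T)) t = defect w (t + T).
Proof.
  unfold defect, force, slope.
  replace (t + tau + T) with (t + T + tau) by ring.
  replace (t - tau + T) with (t + T - tau) by ring.
  now rewrite <- (B_per (w (t + T)) _ t).
Qed.

Lemma defect_periodic_shift_back (w : R -> R) (t : R) :
  defect (fun s => w (s - T)) t = defect w (t - T).
Proof.
  unfold defect, force, slope.
  replace (t + tau - T) with (t - T + tau) by ring.
  replace (t - tau - T) with (t - T - tau) by ring.
  rewrite <- (B_per (w (t - T)) _ (t - T)).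
  now replace (t - T + T) with t by ring.
Qed.

(** The pointwise supremum of all subsolutions is a fixed point of the
    monotone map [relax]: it is a subsolution, hence so is its image, which
    therefore cannot exceed it.  Periodicity comes for free, because the set
    of subsolutions is invariant under translation by a period. *)
Lemma scheme_solution_exists :
  exists u : R -> R,
    (forall t, al t <= u t <= be t) /\ periodic T u /\
    (forall t, defect u t = 0).
Proof.
  assert (Hal : subsolution al).
  { split; intros t; [split; [lra | apply al_le_be]|].
    unfold relax. assert (H := al_lower t). lra. }
  assert (Hlub : forall t, {m | is_lub (fun x => exists w, subsolution w /\ x = w t) m}).
  { intros t. apply completeness.
    - exists (be t). intros x [w [[Hw _] ->]]. apply Hw.
    - exists (al t). now exists al. }
  set (u := fun t => proj1_sig (Hlub t)).
  assert (Hub : forall w, subsolution w -> forall t, w t <= u t).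
  { intros w Hw t. unfold u. destruct (Hlub t) as [m Hm]. simpl.
    apply (proj1 Hm). now exists w. }
  assert (Hle : forall t b, (forall w, subsolution w -> w t <= b) -> u t <= b).
  { intros t b Hb. unfold u. destruct (Hlub t) as [m Hm]. simpl.
    apply (proj2 Hm). intros x [w [Hw ->]]. now apply Hb. }
  assert (Hrange : forall t, al t <= u t <= be t).
  { intros t. split; [now apply Hub|].
    apply Hle. intros w [Hw _]. apply Hw. }
  assert (Hlo : forall w, (forall t, al t <= w t <= be t) ->
     forall t, lo <= w t <= hi).
  { intros w Hw t. specialize (Hw t). assert (H1 := al_ge t).
    assert (H2 := be_le t). lra. }
  assert (Hsub : forall t, u t <= relax u t).
  { intros t. apply Hle. intros w Hw.
    apply Rle_trans with (relax w t); [apply Hw|].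
    destruct Hw as [Hw1 Hw2]. apply relax_monotone.
    - intros s. now apply Hlo.
    - intros s. now apply Hub.
    - intros s. now apply Hlo. }
  assert (Hrelax : subsolution (relax u)).
  { assert (Hr : forall t, al t <= relax u t <= be t).
    { intros t. split.
      - apply Rle_trans with (2 := Hsub t). apply Hrange.
      - apply Rle_trans with (relax be t).
        + apply relax_monotone; intros s; [now apply Hlo | apply Hrange | apply be_le].
        + unfold relax. assert (H := be_upper t). lra. }
    split; [exact Hr|].
    intros t. apply relax_monotone; intros s;
      [now apply Hlo | apply Hsub | now apply Hlo]. }
  exists u. split; [exact Hrange | split].
  - intros t. apply Rle_antisym.
    + apply Hle. intros w [Hw1 Hw2].
      apply (Hub (fun s => w (s + T))). split; intros s.
      * rewrite <- (al_per s), <- (be_per s). apply Hw1.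
      * unfold relax. rewrite defect_periodic_shift. apply Hw2.
    + apply Hle. intros w [Hw1 Hw2].
      replace (w t) with (w (t + T - T)) by (f_equal; ring).
      apply (Hub (fun s => w (s - T))). split; intros s.
      * replace (al s) with (al (s - T)) by (rewrite <- al_per; f_equal; ring).
        replace (be s) with (be (s - T)) by (rewrite <- be_per; f_equal; ring).
        apply Hw1.
      * unfold relax. rewrite defect_periodic_shift_back. apply Hw2.
  - intros t. specialize (Hub _ Hrelax t). specialize (Hsub t).
    unfold relax in *. lra.
Qed.

(** * A priori bounds, uniform in the step *)

Lemma step_slope (w : R -> R) (t : R) : w (t + tau) = w t + tau * slope w t.
Proof. unfold slope. field. lra. Qed.

Lemma increasing_of_slope_pos (w : R -> R) (t : R) (m : nat) :
  (forall j, (j < m)%nat -> 0 < slope w (t + INR j * tau)) ->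
  (0 < m)%nat -> w t < w (t + INR m * tau).
Proof.
  induction m as [|m IH]; intros Hs Hm; [lia|].
  rewrite S_INR. replace (t + (INR m + 1) * tau) with (t + INR m * tau + tau) by ring.
  rewrite step_slope. assert (H := Hs m ltac:(lia)).
  destruct m as [|m].
  - simpl INR in *. replace (t + 0 * tau) with t in * by ring. nra.
  - assert (w t < w (t + INR (S m) * tau)); [|nra].
    apply IH; [|lia]. intros j Hj. apply Hs. lia.
Qed.

Lemma decreasing_of_slope_neg (w : R -> R) (t : R) (m : nat) :
  (forall j, (j < m)%nat -> slope w (t + INR j * tau) < 0) ->
  (0 < m)%nat -> w (t + INR m * tau) < w t.
Proof.
  intros Hs Hm. apply Ropp_lt_cancel.
  apply (increasing_of_slope_pos (fun s => - w s)); trivial.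
  intros j Hj. specialize (Hs j Hj).
  replace (slope (fun s => - w s) (t + INR j * tau))
    with (- slope w (t + INR j * tau)) by (unfold slope; field; lra). lra.
Qed.

Section Bounds.

Context (u : R -> R) (u_range : forall t, lo <= u t <= hi)
  (u_per : periodic T u) (u_eq : forall t, defect u t = 0).

Lemma scheme_slope_step (t : R) :
  slope u (t + tau) - slope u t
  = tau * force (t + tau) (u (t + tau)) (slope u (t + tau)).
Proof.
  assert (He := u_eq (t + tau)). unfold defect in He.
  replace (t + tau - tau) with t in He by ring.
  apply (Rmult_eq_reg_l tau); [|lra].
  replace (tau * (tau * force (t + tau) (u (t + tau)) (slope u (t + tau))))
    with (tau ^ 2 * force (t + tau) (u (t + tau)) (slope u (t + tau))) by ring.
  assert (H1 := step_slope u t). assert (H2 := step_slope u (t + tau)). lra.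
Qed.

(** In the increment of this quantity along the grid the friction term telescopes
    away, which leaves only the bounded part of the force. *)
Definition momentum (t : R) : R := slope u t + mu * u (t + tau).

Lemma momentum_variation (t : R) (j : nat) :
  Rabs (momentum (t + INR j * tau) - momentum t) <= INR j * tau * C.
Proof.
  induction j as [|j IH].
  - simpl INR. replace (t + 0 * tau) with t by ring.
    rewrite Rminus_diag, Rabs_R0. lra.
  - rewrite S_INR.
    replace (t + (INR j + 1) * tau) with (t + INR j * tau + tau) by ring.
    set (s := t + INR j * tau) in *.
    replace (momentum (s + tau) - momentum t)
      with ((momentum s - momentum t)
            + tau * B (s + tau) (u (s + tau)) (slope u (s + tau))).
    + apply Rle_trans with (1 := Rabs_triang _ _).
      rewrite (Rabs_mult tau), (Rabs_pos_eq tau) by lra.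
      assert (H := B_bound (s + tau) (u (s + tau)) (slope u (s + tau))). nra.
    + unfold momentum. assert (H1 := scheme_slope_step s).
      assert (H2 := step_slope u (s + tau)). unfold force in H1.
      rewrite H2. nra.
Qed.

Definition slope_bound : R := mu * (hi - lo) + C * T.

(** Over one period the slope takes both signs; between such a point and [t]
    the quantity [momentum], in which the linear friction has been absorbed,
    changes by at most [C * T]. *)
Lemma slope_le_bound (t : R) : Rabs (slope u t) <= slope_bound.
Proof.
  assert (HNT : forall s, u (s - INR N * tau) = u s).
  { intros s. rewrite <- T_eq, <- u_per. f_equal. ring. }
  assert (HC : 0 <= C) by (apply Rle_trans with (2 := B_bound 0 0 0); apply Rabs_pos).
  assert (Hdrop : forall j, (j < N)%nat ->
    Rabs (momentum t - momentum (t - INR N * tau + INR j * tau)) <= C * T).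
  { intros j Hj.
    replace t with (t - INR N * tau + INR j * tau + INR (N - j) * tau) at 1
      by (rewrite minus_INR by lia; ring).
    apply Rle_trans with (1 := momentum_variation _ _).
    rewrite T_eq. assert (INR (N - j) <= INR N) by (apply le_INR; lia).
    assert (0 <= tau * C) by nra. nra. }
  (* Both signs occur, since [u] returns to its value after [N] steps. *)
  assert (H1 : exists j, (j < N)%nat /\ slope u (t - INR N * tau + INR j * tau) <= 0).
  { apply NNPP. intros Hno.
    assert (H := increasing_of_slope_pos u (t - INR N * tau) N).
    replace (t - INR N * tau + INR N * tau) with t in H by ring.
    rewrite HNT in H. apply (Rlt_irrefl (u t)), H; trivial.
    intros j Hj. apply Rnot_le_lt. intros Hle. apply Hno. now exists j. }
  assert (H2 : exists j, (j < N)%nat /\ 0 <= slope u (t - INR N * tau + INR j * tau)).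
  { apply NNPP. intros Hno.
    assert (H := decreasing_of_slope_neg u (t - INR N * tau) N).
    replace (t - INR N * tau + INR N * tau) with t in H by ring.
    rewrite HNT in H. apply (Rlt_irrefl (u t)), H; trivial.
    intros j Hj. apply Rnot_le_lt. intros Hle. apply Hno. now exists j. }
  destruct H1 as [j1 [Hj1 Hs1]]. destruct H2 as [j2 [Hj2 Hs2]].
  assert (Ha := proj1 (Rabs_le_between _ _) (Hdrop j1 Hj1)).
  assert (Hb := proj1 (Rabs_le_between _ _) (Hdrop j2 Hj2)).
  unfold momentum in Ha, Hb. unfold slope_bound.
  assert (R0 := u_range (t + tau)).
  assert (R1 := u_range (t - INR N * tau + INR j1 * tau + tau)).
  assert (R2 := u_range (t - INR N * tau + INR j2 * tau + tau)).
  apply Rabs_le. split; nra.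
Qed.

Definition force_bound : R := mu * slope_bound + C.

Lemma force_le_bound (t : R) : Rabs (force t (u t) (slope u t)) <= force_bound.
Proof.
  unfold force, force_bound. apply Rle_trans with (1 := Rabs_triang _ _).
  rewrite Rabs_mult, Rabs_Ropp, (Rabs_pos_eq mu) by lra.
  assert (H1 := slope_le_bound t). assert (H2 := B_bound t (u t) (slope u t)). nra.
Qed.

Lemma slope_variation (t : R) (j : nat) :
  Rabs (slope u (t + INR j * tau) - slope u t) <= force_bound * (INR j * tau).
Proof.
  induction j as [|j IH].
  - simpl INR. replace (t + 0 * tau) with t by ring.
    rewrite Rminus_diag, Rabs_R0. lra.
  - rewrite S_INR.
    replace (t + (INR j + 1) * tau) with (t + INR j * tau + tau) by ring.
    set (s := t + INR j * tau) in *.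
    replace (slope u (s + tau) - slope u t)
      with ((slope u (s + tau) - slope u s) + (slope u s - slope u t)) by ring.
    apply Rle_trans with (1 := Rabs_triang _ _).
    rewrite scheme_slope_step, Rabs_mult, (Rabs_pos_eq tau) by lra.
    assert (H := force_le_bound (s + tau)). nra.
Qed.

Lemma solution_variation (t : R) (j : nat) :
  Rabs (u (t + INR j * tau) - u t) <= slope_bound * (INR j * tau).
Proof.
  induction j as [|j IH].
  - simpl INR. replace (t + 0 * tau) with t by ring.
    rewrite Rminus_diag, Rabs_R0. lra.
  - rewrite S_INR.
    replace (t + (INR j + 1) * tau) with (t + INR j * tau + tau) by ring.
    set (s := t + INR j * tau) in *.
    rewrite step_slope.
    replace (u s + tau * slope u s - u t)
      with (tau * slope u s + (u s - u t)) by ring.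
    apply Rle_trans with (1 := Rabs_triang _ _).
    rewrite Rabs_mult, (Rabs_pos_eq tau) by lra.
    assert (H := slope_le_bound s). nra.
Qed.

Lemma solution_taylor (t : R) (j : nat) :
  Rabs (u (t + INR j * tau) - u t - INR j * tau * slope u t)
  <= force_bound * (INR j * tau) ^ 2.
Proof.
  assert (HA : 0 <= force_bound)
    by (apply Rle_trans with (2 := force_le_bound 0); apply Rabs_pos).
  induction j as [|j IH].
  - simpl INR. replace (t + 0 * tau) with t by ring.
    rewrite Rminus_diag, Rmult_0_l, Rmult_0_l, Rminus_0_r, Rabs_R0. lra.
  - rewrite S_INR. assert (Hj := pos_INR j). assert (Hv := slope_variation t j).
    replace (t + (INR j + 1) * tau) with (t + INR j * tau + tau) by ring.
    set (s := t + INR j * tau) in *.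
    rewrite step_slope.
    replace (u s + tau * slope u s - u t - (INR j + 1) * tau * slope u t)
      with ((u s - u t - INR j * tau * slope u t)
            + tau * (slope u s - slope u t)) by ring.
    apply Rle_trans with (1 := Rabs_triang _ _).
    rewrite (Rabs_mult tau), (Rabs_pos_eq tau) by lra.
    apply Rle_trans with
      (force_bound * (INR j * tau) ^ 2 + tau * (force_bound * (INR j * tau))).
    + apply Rplus_le_compat; trivial. apply Rmult_le_compat_l; lra.
    + assert (0 <= INR j * tau) by nra.
      assert (0 <= force_bound * (INR j * tau * tau + tau * tau)); [|nra].
      apply Rmult_le_pos; nra.
Qed.

Definition force_variation_bound : R :=
  mu * force_bound + L * (1 + slope_bound + force_bound).

Lemma force_variation (t : R) (j : nat) :
  Rabs (force (t + INR j * tau) (u (t + INR j * tau)) (slope u (t + INR j * tau))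
        - force t (u t) (slope u t))
  <= force_variation_bound * (INR j * tau).
Proof.
  assert (Hs := slope_variation t j). assert (Hu := solution_variation t j).
  assert (Hj : 0 <= INR j * tau) by (assert (Hj := pos_INR j); nra).
  assert (HB := B_lip (t + INR j * tau) (u (t + INR j * tau))
    (slope u (t + INR j * tau)) t (u t) (slope u t) (u_range _) (u_range _)).
  unfold force.
  set (s := t + INR j * tau) in *.
  assert (Hts : Rabs (s - t) = INR j * tau).
  { unfold s. rewrite Rabs_pos_eq; lra. }
  rewrite Hts in HB.
  replace (- mu * slope u s + B s (u s) (slope u s)
     - (- mu * slope u t + B t (u t) (slope u t)))
    with (- mu * (slope u s - slope u t)
          + (B s (u s) (slope u s) - B t (u t) (slope u t))) by ring.
  apply Rle_trans with (1 := Rabs_triang _ _).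
  rewrite (Rabs_mult (- mu)), Rabs_Ropp, (Rabs_pos_eq mu) by lra.
  apply Rle_trans with
    (mu * (force_bound * (INR j * tau))
     + L * (INR j * tau + slope_bound * (INR j * tau) + force_bound * (INR j * tau))).
  - apply Rplus_le_compat.
    + now apply Rmult_le_compat_l.
    + apply Rle_trans with (1 := HB). apply Rmult_le_compat_l; lra.
  - right. unfold force_variation_bound. ring.
Qed.

Lemma slope_taylor (t : R) (j : nat) :
  Rabs (slope u (t + INR j * tau) - slope u t
        - INR j * tau * force t (u t) (slope u t))
  <= force_variation_bound * (INR j * tau) * (INR j * tau).
Proof.
  assert (HA : 0 <= force_variation_bound).
  { assert (H := force_variation t 1). simpl INR in H.
    assert (H0 := Rle_trans _ _ _ (Rabs_pos _) H). nra. }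
  induction j as [|j IH].
  - simpl INR. replace (t + 0 * tau) with t by ring.
    rewrite Rminus_diag, Rmult_0_l, Rmult_0_l, Rminus_0_r, Rabs_R0. lra.
  - assert (Hv := force_variation t (S j)). rewrite S_INR in *.
    assert (Hj := pos_INR j).
    replace (t + (INR j + 1) * tau) with (t + INR j * tau + tau) in * by ring.
    set (s := t + INR j * tau) in *.
    replace (slope u (s + tau) - slope u t
             - (INR j + 1) * tau * force t (u t) (slope u t))
      with ((slope u s - slope u t - INR j * tau * force t (u t) (slope u t))
            + tau * (force (s + tau) (u (s + tau)) (slope u (s + tau))
                     - force t (u t) (slope u t)))
      by (assert (H := scheme_slope_step s); lra).
    apply Rle_trans with (1 := Rabs_triang _ _).
    rewrite (Rabs_mult tau), (Rabs_pos_eq tau) by lra.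
    apply Rle_trans with
      (force_variation_bound * (INR j * tau) * (INR j * tau)
       + tau * (force_variation_bound * ((INR j + 1) * tau))).
    + apply Rplus_le_compat; trivial. apply Rmult_le_compat_l; lra.
    + assert (0 <= INR j * tau) by nra.
      assert (0 <= force_variation_bound * (INR j * tau * tau)); [|nra].
      apply Rmult_le_pos; nra.
Qed.

End Bounds.

End Scheme.

(** * Periodic solutions between a lower and an upper solution *)

Lemma is_derive_of_quadratic_bound (g : R -> R) (x l K : R) :
  (forall y, Rabs (g y - g x - (y - x) * l) <= K * (y - x) ^ 2) ->
  is_derive g x l.
Proof.
  intros Hq. apply is_derive_Reals. intros eps Heps.
  assert (HK : 0 < Rabs K + 1) by (assert (H := Rabs_pos K); lra).
  assert (Hd : 0 < eps / (Rabs K + 1)) by (now apply Rdiv_lt_0_compat).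
  exists (mkposreal _ Hd). intros d Hd0 Hdd. simpl in Hdd.
  specialize (Hq (x + d)). replace (x + d - x) with d in Hq by ring.
  replace ((g (x + d) - g x) / d - l) with ((g (x + d) - g x - d * l) / d)
    by now field.
  unfold Rdiv. rewrite Rabs_mult, Rabs_inv.
  assert (Hp : 0 < Rabs d) by now apply Rabs_pos_lt.
  apply Rmult_lt_reg_r with (Rabs d); trivial.
  rewrite Rmult_assoc, Rinv_l, Rmult_1_r by lra.
  apply Rle_lt_trans with (1 := Hq). rewrite <- pow2_abs.
  assert (HKd : (Rabs K + 1) * Rabs d < eps).
  { apply Rmult_lt_compat_l with (r := Rabs K + 1) in Hdd; trivial.
    replace ((Rabs K + 1) * (eps / (Rabs K + 1))) with eps in Hdd by (field; lra).
    exact Hdd. }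
  assert (H := Rle_abs K). nra.
Qed.

(** One-sided Taylor estimates suffice when they are uniform in the base point:
    backward increments are expanded at their left end, which changes the
    derivative by a quantity of the order of the increment. *)
Lemma is_derive_of_forward_bound (g g' : R -> R) (K : R) :
  (forall s t, s <= t -> Rabs (g t - g s - (t - s) * g' s) <= K * (t - s) ^ 2) ->
  (forall s t, s <= t -> Rabs (g' t - g' s) <= K * (t - s)) ->
  forall t, is_derive g t (g' t).
Proof.
  intros H1 H2 t. apply is_derive_of_quadratic_bound with (K := 2 * K). intros y.
  assert (HK : 0 <= K).
  { assert (H := H2 0 1 ltac:(lra)). assert (H0 := Rabs_pos (g' 1 - g' 0)). lra. }
  destruct (Rle_dec t y) as [Hty|Hty].
  - specialize (H1 t y Hty).
    assert (0 <= K * (y - t) ^ 2) by (apply Rmult_le_pos; [lra | apply pow2_ge_0]). lra.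
  - assert (Hyt : y <= t) by lra. specialize (H1 y t Hyt). specialize (H2 y t Hyt).
    replace (g y - g t - (y - t) * g' t)
      with (- (g t - g y - (t - y) * g' y) + (t - y) * (g' t - g' y)) by ring.
    apply Rle_trans with (1 := Rabs_triang _ _).
    rewrite Rabs_Ropp, Rabs_mult, (Rabs_pos_eq (t - y)) by lra.
    apply Rle_trans with (K * (t - y) ^ 2 + (t - y) * (K * (t - y))); [|nra].
    apply Rplus_le_compat; trivial. apply Rmult_le_compat_l; lra.
Qed.

(** * Grid points *)

Definition grid (tau t : R) : R := tau * IZR (Int_part (t / tau)).

Lemma grid_close (tau t : R) : 0 < tau -> Rabs (grid tau t - t) <= tau.
Proof.
  intros Htau. unfold grid. destruct (base_Int_part (t / tau)) as [H1 H2].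
  set (z := IZR (Int_part (t / tau))) in *.
  replace (tau * z - t) with (tau * (z - t / tau)) by (field; lra).
  apply Rabs_le. nra.
Qed.

Lemma grid_shift (tau t : R) (n : nat) :
  0 < tau -> grid tau (t + INR n * tau) = grid tau t + INR n * tau.
Proof.
  intros Htau. unfold grid.
  replace (Int_part ((t + INR n * tau) / tau)) with (Int_part (t / tau) + Z.of_nat n)%Z.
  - rewrite plus_IZR, <- INR_IZR_INZ. ring.
  - apply Int_part_spec. rewrite plus_IZR, <- INR_IZR_INZ.
    destruct (base_Int_part (t / tau)) as [H1 H2].
    replace ((t + INR n * tau) / tau) with (t / tau + INR n) by (field; lra). lra.
Qed.

Lemma grid_monotone_steps (tau s t : R) :
  0 < tau -> s <= t -> exists j : nat, grid tau t = grid tau s + INR j * tau.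
Proof.
  intros Htau Hst. unfold grid.
  destruct (base_Int_part (s / tau)) as [H1 H2].
  destruct (base_Int_part (t / tau)) as [H3 H4].
  assert (Hle : s / tau <= t / tau).
  { apply Rmult_le_compat_r; trivial. left. now apply Rinv_0_lt_compat. }
  assert (Hz : (Int_part (s / tau) <= Int_part (t / tau))%Z).
  { apply Z.lt_succ_r. apply lt_IZR. rewrite succ_IZR. lra. }
  exists (Z.to_nat (Int_part (t / tau) - Int_part (s / tau))).
  rewrite INR_IZR_INZ, Z2Nat.id by lia. rewrite minus_IZR. ring.
Qed.

(** * Consistency of the scheme *)

Lemma second_order_taylor (g g1 g2 : R -> R) (L : R) (t s : R) :
  (forall x, is_derive g x (g1 x)) -> (forall x, is_derive g1 x (g2 x)) ->
  (forall x y, Rabs (g2 x - g2 y) <= L * Rabs (x - y)) ->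
  Rabs (g s - g t - (s - t) * g1 t - (s - t) ^ 2 / 2 * g2 t)
  <= L * Rabs (s - t) ^ 3.
Proof.
  intros Hg Hg1 HL.
  assert (HL0 : 0 <= L).
  { assert (H := HL 1 0). rewrite Rminus_0_r, Rabs_R1 in H.
    assert (H0 := Rabs_pos (g2 1 - g2 0)). lra. }
  set (d := Rabs (s - t)). assert (Hd : 0 <= d) by apply Rabs_pos.
  assert (H1 : forall x, Rabs (x - t) <= d ->
    Rabs (g1 x - g1 t - (x - t) * g2 t) <= L * d * d).
  { intros x Hx.
    replace (g1 x - g1 t - (x - t) * g2 t)
      with ((g1 x - (x - t) * g2 t) - (g1 t - (t - t) * g2 t)) by ring.
    apply Rle_trans with (L * d * Rabs (x - t)).
    - apply (bounded_variation (fun y => g1 y - (y - t) * g2 t) (fun y => g2 y - g2 t)).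
      intros y Hy. split.
      + auto_derive; [now exists (g2 y)|].
        replace (Derive (fun x0 => g1 x0) y) with (g2 y)
          by (symmetry; now apply is_derive_unique). ring.
      + apply Rle_trans with (1 := HL y t).
        apply Rmult_le_compat_l; lra.
    - apply Rmult_le_compat_l; [nra | trivial]. }
  replace (g s - g t - (s - t) * g1 t - (s - t) ^ 2 / 2 * g2 t)
    with ((g s - (s - t) * g1 t - (s - t) ^ 2 / 2 * g2 t)
          - (g t - (t - t) * g1 t - (t - t) ^ 2 / 2 * g2 t)) by field.
  replace (L * d ^ 3) with (L * d * d * Rabs (s - t)) by (unfold d; ring).
  apply (bounded_variation (fun y => g y - (y - t) * g1 t - (y - t) ^ 2 / 2 * g2 t)
    (fun y => g1 y - g1 t - (y - t) * g2 t)).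
  intros y Hy. split; [|now apply H1].
  auto_derive; [now exists (g1 y)|].
  replace (Derive (fun x0 => g x0) y) with (g1 y)
    by (symmetry; now apply is_derive_unique). field.
Qed.

(** A strict differential inequality with margin [eta] thus passes to the scheme
    as soon as the second factor on the right is below [eta]. *)
Lemma defect_consistency (mu L lo hi L2 D tau : R) (B : R -> R -> R -> R)
  (g g1 g2 : R -> R) (t : R) :
  0 < tau -> 0 <= mu -> 0 <= L ->
  (forall t u v t' u' v', lo <= u <= hi -> lo <= u' <= hi ->
     Rabs (B t u v - B t' u' v')
     <= L * (Rabs (t - t') + Rabs (u - u') + Rabs (v - v'))) ->
  (forall x, is_derive g x (g1 x)) -> (forall x, is_derive g1 x (g2 x)) ->
  (forall x y, Rabs (g2 x - g2 y) <= L2 * Rabs (x - y)) ->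
  (forall x, Rabs (g2 x) <= D) -> (forall x, lo <= g x <= hi) ->
  Rabs (defect mu tau B g t - tau ^ 2 * (g2 t - force mu B t (g t) (g1 t)))
  <= tau ^ 2 * (tau * (2 * L2 + (L + mu) * D)).
Proof.
  intros Htau Hmu HL HB Hg Hg1 HL2 HD Hr.
  assert (Hp := second_order_taylor g g1 g2 L2 t (t + tau) Hg Hg1 HL2).
  assert (Hm := second_order_taylor g g1 g2 L2 t (t - tau) Hg Hg1 HL2).
  replace (t + tau - t) with tau in Hp by ring.
  replace (t - tau - t) with (- tau) in Hm by ring.
  rewrite Rabs_Ropp in Hm. rewrite (Rabs_pos_eq tau) in Hp, Hm by lra.
  assert (Hs : Rabs (slope tau g t - g1 t) <= D * tau).
  { unfold slope.
    replace ((g (t + tau) - g t) / tau - g1 t)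
      with ((g (t + tau) - (t + tau - t) * g1 t - (g t - (t - t) * g1 t)) / tau)
      by (field; lra).
    unfold Rdiv. rewrite Rabs_mult, Rabs_inv, (Rabs_pos_eq tau) by lra.
    apply Rmult_le_reg_r with tau; trivial.
    rewrite Rmult_assoc, Rinv_l, Rmult_1_r by lra.
    replace (D * tau * tau) with (D * tau * Rabs (t + tau - t))
      by (replace (t + tau - t) with tau by ring; rewrite Rabs_pos_eq; lra).
    apply (bounded_variation (fun y => g y - (y - t) * g1 t) (fun y => g1 y - g1 t)).
    intros y Hy. split.
    - auto_derive; [now exists (g1 y)|].
      replace (Derive (fun x0 => g x0) y) with (g1 y)
        by (symmetry; now apply is_derive_unique). ring.
    - apply Rle_trans with (D * Rabs (y - t)).
      + apply (bounded_variation g1 g2). intros z _. now split.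
      + apply Rmult_le_compat_l.
        * apply Rle_trans with (2 := HD 0). apply Rabs_pos.
        * replace (t + tau - t) with tau in Hy by ring.
          rewrite (Rabs_pos_eq tau) in Hy; lra. }
  assert (Hf : Rabs (force mu B t (g t) (slope tau g t) - force mu B t (g t) (g1 t))
     <= (L + mu) * (D * tau)).
  { unfold force.
    replace (- mu * slope tau g t + B t (g t) (slope tau g t)
             - (- mu * g1 t + B t (g t) (g1 t)))
      with (B t (g t) (slope tau g t) - B t (g t) (g1 t)
            + - mu * (slope tau g t - g1 t)) by ring.
    apply Rle_trans with (1 := Rabs_triang _ _).
    rewrite Rabs_mult, Rabs_Ropp, (Rabs_pos_eq mu) by lra.
    assert (H := HB t (g t) (slope tau g t) t (g t) (g1 t) (Hr t) (Hr t)).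
    rewrite !Rminus_diag, Rabs_R0, !Rplus_0_l in H. nra. }
  unfold defect.
  apply Rabs_le_between in Hp, Hm, Hf. apply Rabs_le.
  set (F1 := force mu B t (g t) (slope tau g t)) in *.
  set (F2 := force mu B t (g t) (g1 t)) in *.
  assert (Ht2 : 0 < tau ^ 2) by nra.
  assert (Hf1 := Rmult_le_compat_l _ _ _ (Rlt_le _ _ Ht2) (proj1 Hf)).
  assert (Hf2 := Rmult_le_compat_l _ _ _ (Rlt_le _ _ Ht2) (proj2 Hf)).
  split; nra.
Qed.

Ltac filterlim_arith FU :=
  repeat match goal with
  | |- filterlim (fun n => Rabs (@?f n)) _ _ => apply (filterlim_Rabs_comp FU f)
  | |- filterlim (fun n => @?f n - @?g n) _ _ => apply (filterlim_Rminus FU f g)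
  | |- filterlim (fun n => @?f n + @?g n) _ _ => apply (filterlim_Rplus FU f g)
  | |- filterlim (fun n => @?f n * @?g n) _ _ => apply (filterlim_Rmult FU f g)
  end; trivial.

Section Existence.

Context (T mu C L L2 D lo hi eta : R) (B : R -> R -> R -> R)
  (al al1 al2 be be1 be2 : R -> R).
Context (T_pos : 0 < T) (mu_nonneg : 0 <= mu) (L_nonneg : 0 <= L)
  (eta_pos : 0 < eta).
Context (B_bound : forall t u v, Rabs (B t u v) <= C).
Context (B_lip : forall t u v t' u' v', lo <= u <= hi -> lo <= u' <= hi ->
  Rabs (B t u v - B t' u' v')
  <= L * (Rabs (t - t') + Rabs (u - u') + Rabs (v - v'))).
Context (B_per : forall u v, periodic T (fun t => B t u v)).
Context (al_per : periodic T al) (be_per : periodic T be)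
  (al_ge : forall t, lo <= al t) (al_le_be : forall t, al t <= be t)
  (be_le : forall t, be t <= hi).
Context (al_derive : forall t, is_derive al t (al1 t))
  (al1_derive : forall t, is_derive al1 t (al2 t))
  (al2_lip : forall s t, Rabs (al2 s - al2 t) <= L2 * Rabs (s - t))
  (al2_bound : forall t, Rabs (al2 t) <= D).
Context (be_derive : forall t, is_derive be t (be1 t))
  (be1_derive : forall t, is_derive be1 t (be2 t))
  (be2_lip : forall s t, Rabs (be2 s - be2 t) <= L2 * Rabs (s - t))
  (be2_bound : forall t, Rabs (be2 t) <= D).
Context (al_lower : forall t, eta <= al2 t - force mu B t (al t) (al1 t))
  (be_upper : forall t, be2 t - force mu B t (be t) (be1 t) <= - eta).

Lemma fine_step_exists :
  exists n0 : nat, (0 < n0)%nat /\ forall n : nat, (n0 <= n)%nat ->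
    let tau := T / INR n in
    0 < tau <= 1 /\ tau * (L + mu) <= 1 /\
    (forall t, 0 <= defect mu tau B al t) /\ (forall t, defect mu tau B be t <= 0).
Proof.
  assert (HD : 0 <= D) by (apply Rle_trans with (2 := al2_bound 0); apply Rabs_pos).
  assert (HL2 : 0 <= L2).
  { assert (H := al2_lip 1 0). rewrite Rminus_0_r, Rabs_R1 in H.
    assert (H0 := Rabs_pos (al2 1 - al2 0)). lra. }
  set (K := 2 * L2 + (L + mu) * D).
  assert (HK : 0 <= K) by (unfold K; nra).
  (* [tau * M <= 1] gives the three smallness conditions at once. *)
  set (M := 1 + (L + mu) + K / eta).
  assert (HKe : 0 <= K / eta)
    by (apply Rmult_le_pos; [trivial | left; now apply Rinv_0_lt_compat]).
  destruct (nfloor_ex (T * M)) as [n0 Hn0]; [unfold M; nra|].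
  exists (S n0). split; [lia|]. intros n Hn tau.
  assert (Hn1 : T * M <= INR n).
  { apply le_INR in Hn. rewrite S_INR in Hn. lra. }
  assert (HnP : 0 < INR n) by (apply lt_0_INR; lia).
  assert (Htau : 0 < tau) by (unfold tau; now apply Rdiv_lt_0_compat).
  assert (HtM : tau * M <= 1).
  { unfold tau. apply Rmult_le_reg_r with (INR n); trivial.
    replace (T / INR n * M * INR n) with (T * M) by (field; lra). lra. }
  assert (HM : tau * M = tau + tau * (L + mu) + tau * (K / eta)) by (unfold M; ring).
  assert (P1 : 0 <= tau * (L + mu)) by nra.
  assert (P2 : 0 <= tau * (K / eta)) by nra.
  assert (HKeta : tau * K <= eta).
  { replace (tau * K) with (tau * (K / eta) * eta) by (field; lra). nra. }
  split; [lra|]. split; [lra|].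
  assert (Ht2 : 0 <= tau ^ 2) by nra.
  split; intros t.
  - assert (H := defect_consistency mu L lo hi L2 D tau B al al1 al2 t Htau
      mu_nonneg L_nonneg B_lip al_derive al1_derive al2_lip al2_bound
      (fun x => conj (al_ge x) (Rle_trans _ _ _ (al_le_be x) (be_le x)))).
    fold K in H. apply Rabs_le_between in H. assert (He := al_lower t).
    assert (0 <= tau ^ 2 * (al2 t - force mu B t (al t) (al1 t) - tau * K));
      [|lra].
    apply Rmult_le_pos; lra.
  - assert (H := defect_consistency mu L lo hi L2 D tau B be be1 be2 t Htau
      mu_nonneg L_nonneg B_lip be_derive be1_derive be2_lip be2_bound
      (fun x => conj (Rle_trans _ _ _ (al_ge x) (al_le_be x)) (be_le x))).
    fold K in H. apply Rabs_le_between in H. assert (He := be_upper t).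
    assert (0 <= tau ^ 2 * (- (be2 t - force mu B t (be t) (be1 t)) - tau * K));
      [|lra].
    apply Rmult_le_pos; lra.
Qed.

(** The solutions of the scheme are only known on grids, and need not be
    continuous across them; they are sampled at the grid point next to [t] before
    the limit is taken.  The discrete Taylor estimates pass to the limit and give
    the derivatives directly, without integrating. *)
Theorem periodic_solution_between :
  exists u v : R -> R,
    (forall t, is_derive u t (v t)) /\
    (forall t, is_derive v t (- mu * v t + B t (u t) (v t))) /\
    periodic T u /\ periodic T v /\
    (forall t, al t <= u t <= be t) /\
    (forall t, Rabs (v t) <= mu * (hi - lo) + C * T).
Proof.
  destruct fine_step_exists as [n0 [Hn0 Hfine]].
  set (tau := fun n => T / INR (n + n0)).
  assert (Hstep : forall n, 0 < tau n <= 1 /\ tau n * (L + mu) <= 1 /\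
    (forall t, 0 <= defect mu (tau n) B al t) /\
    (forall t, defect mu (tau n) B be t <= 0)).
  { intros n. apply Hfine. lia. }
  assert (Hpos : forall n, 0 < tau n) by (intros n; apply Hstep).
  assert (HT : forall n, T = INR (n + n0) * tau n).
  { intros n. unfold tau. field. apply not_0_INR. lia. }
  assert (HNp : forall n, (0 < n + n0)%nat) by (intros n; lia).
  destruct (functional_choice (fun n u =>
    (forall t, al t <= u t <= be t) /\ periodic T u /\
    (forall t, defect mu (tau n) B u t = 0))) as [w Hw].
  { intros n. destruct (Hstep n) as [H1 [H2 [H3 H4]]].
    apply (scheme_solution_exists T mu L lo hi (tau n) B al be); trivial; apply H1. }
  assert (Hwr : forall n t, lo <= w n t <= hi).
  { intros n t. destruct (Hw n) as [H _]. specialize (H t).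
    assert (H1 := al_ge t). assert (H2 := be_le t). lra. }
  set (V := slope_bound T mu C lo hi).
  set (A := force_bound T mu C lo hi).
  set (K := force_variation_bound T mu C L lo hi).
  set (x := fun t n => w n (grid (tau n) t)).
  set (y := fun t n => slope (tau n) (w n) (grid (tau n) t)).
  set (F := fun t n => force mu B (grid (tau n) t) (x t n) (y t n)).
  assert (Hy : forall t n, Rabs (y t n) <= V).
  { intros t n. destruct (Hw n) as [_ [H2 H3]].
    now apply (slope_le_bound T mu C lo hi (tau n) (n + n0) B). }
  destruct free_ultrafilter_exists as [U [FU [HU Hev]]].
  destruct (functional_choice (fun t l => filterlim (x t) U (locally l))) as [u Hu].
  { intros t. apply (ultra_bounded_lim U FU HU) with lo hi. intros n. apply Hwr. }
  destruct (functional_choice (fun t l => filterlim (y t) U (locally l))) as [v Hv].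
  { intros t. apply (ultra_bounded_lim U FU HU) with (- V) V. intros n.
    apply Rabs_le_between, Hy. }
  assert (Htau0 : filterlim tau U (locally 0)).
  { apply filterlim_locally. intros eps. apply Hev.
    assert (He := cond_pos eps).
    destruct (nfloor_ex (T / eps)) as [m Hm].
    { apply Rlt_le, Rdiv_lt_0_compat; trivial. }
    exists (S m). intros n Hn. change (Rabs (tau n - 0) < eps).
    rewrite Rminus_0_r, Rabs_pos_eq by (left; apply Hpos).
    apply le_INR in Hn. rewrite S_INR in Hn.
    assert (Hn' : T / eps < INR (n + n0))
      by (rewrite plus_INR; assert (H := pos_INR n0); lra).
    assert (HP : 0 < INR (n + n0)) by (apply lt_0_INR; lia).
    unfold tau. apply Rmult_lt_reg_r with (INR (n + n0)); trivial.
    replace (T / INR (n + n0) * INR (n + n0)) with T by (field; lra).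
    apply Rmult_lt_compat_r with (r := eps) in Hn'; trivial.
    replace (T / eps * eps) with T in Hn' by (field; lra). lra. }
  assert (Hgrid : forall t, filterlim (fun n => grid (tau n) t) U (locally t)).
  { intros t. apply (filterlim_of_bound FU _ tau); trivial.
    intros n. now apply grid_close. }
  assert (Hconst : forall c : R, filterlim (fun _ : nat => c) U (locally c))
    by (intros c; apply filterlim_const).
  assert (Hur : forall t, lo <= u t <= hi).
  { intros t. split; [apply (filterlim_Rle FU (fun _ => lo) (x t)) |
      apply (filterlim_Rle FU (x t) (fun _ => hi))]; trivial; intros n; apply Hwr. }
  assert (HF : forall t, filterlim (F t) U (locally (force mu B t (u t) (v t)))).
  { intros t. unfold F, force. apply (filterlim_Rplus FU).
    - apply (filterlim_Rmult FU); trivial.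
    - apply (filterlim_of_bound FU _
        (fun n => L * (Rabs (grid (tau n) t - t) + Rabs (x t n - u t)
                       + Rabs (y t n - v t)))).
      + intros n. apply B_lip; [apply Hwr | apply Hur].
      + replace 0 with (L * (Rabs (t - t) + Rabs (u t - u t) + Rabs (v t - v t)))
          by (rewrite !Rminus_diag, Rabs_R0; ring).
        filterlim_arith FU. }
  assert (Hlen : forall s t, filterlim (fun n => grid (tau n) t - grid (tau n) s) U
    (locally (t - s))).
  { intros s t. now apply (filterlim_Rminus FU). }
  assert (Hvar_u : forall s t, s <= t ->
    Rabs (u t - u s - (t - s) * v s) <= A * (t - s) ^ 2).
  { intros s t Hst. simpl.
    apply (filterlim_Rle FU
      (fun n => Rabs (x t n - x s n - (grid (tau n) t - grid (tau n) s) * y s n))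
      (fun n => A * ((grid (tau n) t - grid (tau n) s)
                     * ((grid (tau n) t - grid (tau n) s) * 1)))).
    - intros n. destruct (Hw n) as [_ [H2 H3]].
      destruct (grid_monotone_steps (tau n) s t (Hpos n) Hst) as [j Hj].
      unfold x, y. rewrite Hj.
      replace (grid (tau n) s + INR j * tau n - grid (tau n) s)
        with (INR j * tau n) by ring.
      now apply (solution_taylor T mu C lo hi (tau n) (n + n0) B).
    - filterlim_arith FU.
    - filterlim_arith FU. }
  assert (Hvar_v : forall s t, s <= t -> Rabs (v t - v s) <= A * (t - s)).
  { intros s t Hst.
    apply (filterlim_Rle FU (fun n => Rabs (y t n - y s n))
      (fun n => A * (grid (tau n) t - grid (tau n) s))).
    - intros n. destruct (Hw n) as [_ [H2 H3]].
      destruct (grid_monotone_steps (tau n) s t (Hpos n) Hst) as [j Hj].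
      unfold x, y. rewrite Hj.
      replace (grid (tau n) s + INR j * tau n - grid (tau n) s)
        with (INR j * tau n) by ring.
      now apply (slope_variation T mu C lo hi (tau n) (n + n0) B).
    - apply (filterlim_Rabs_comp FU), (filterlim_Rminus FU); trivial.
    - apply (filterlim_Rmult FU); trivial. }
  assert (Htay_v : forall s t, s <= t ->
    Rabs (v t - v s - (t - s) * force mu B s (u s) (v s)) <= K * (t - s) ^ 2).
  { intros s t Hst. replace (K * (t - s) ^ 2) with (K * (t - s) * (t - s)) by ring.
    apply (filterlim_Rle FU
      (fun n => Rabs (y t n - y s n - (grid (tau n) t - grid (tau n) s) * F s n))
      (fun n => K * (grid (tau n) t - grid (tau n) s)
                * (grid (tau n) t - grid (tau n) s))).
    - intros n. destruct (Hw n) as [_ [H2 H3]].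
      destruct (grid_monotone_steps (tau n) s t (Hpos n) Hst) as [j Hj].
      unfold F, x, y. rewrite Hj.
      replace (grid (tau n) s + INR j * tau n - grid (tau n) s)
        with (INR j * tau n) by ring.
      now apply (slope_taylor T mu C L lo hi (tau n) (n + n0) B).
    - filterlim_arith FU.
    - filterlim_arith FU. }
  assert (Hvar_F : forall s t, s <= t ->
    Rabs (force mu B t (u t) (v t) - force mu B s (u s) (v s)) <= K * (t - s)).
  { intros s t Hst.
    apply (filterlim_Rle FU (fun n => Rabs (F t n - F s n))
      (fun n => K * (grid (tau n) t - grid (tau n) s))).
    - intros n. destruct (Hw n) as [_ [H2 H3]].
      destruct (grid_monotone_steps (tau n) s t (Hpos n) Hst) as [j Hj].
      unfold F, x, y. rewrite Hj.
      replace (grid (tau n) s + INR j * tau n - grid (tau n) s)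
        with (INR j * tau n) by ring.
      now apply (force_variation T mu C L lo hi (tau n) (n + n0) B).
    - apply (filterlim_Rabs_comp FU), (filterlim_Rminus FU); trivial.
    - apply (filterlim_Rmult FU); trivial. }
  assert (Hshift : forall n t, grid (tau n) (t + T) = grid (tau n) t + T).
  { intros n t. rewrite (HT n) at 1 2. now apply grid_shift. }
  assert (Hxper : forall t n, x (t + T) n = x t n).
  { intros t n. unfold x. rewrite Hshift. apply (Hw n). }
  assert (Hyper : forall t n, y (t + T) n = y t n).
  { intros t n. unfold y, slope. rewrite Hshift.
    destruct (Hw n) as [_ [H2 _]].
    replace (grid (tau n) t + T + tau n) with (grid (tau n) t + tau n + T) by ring.
    rewrite (H2 (grid (tau n) t + tau n)), (H2 (grid (tau n) t)). reflexivity. }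
  exists u, v.
  split. { now apply is_derive_of_forward_bound with A. }
  split. { now apply (is_derive_of_forward_bound v
    (fun t => force mu B t (u t) (v t))) with K. }
  split.
  { intros t. apply Rle_antisym; eapply (filterlim_Rle FU); try apply Hu;
      intros n; rewrite Hxper; lra. }
  split.
  { intros t. apply Rle_antisym; eapply (filterlim_Rle FU); try apply Hv;
      intros n; rewrite Hyper; lra. }
  split.
  { assert (Hcont : forall g g1 : R -> R, (forall t, is_derive g t (g1 t)) -> forall t,
      filterlim (fun n => g (grid (tau n) t)) U (locally (g t))).
    { intros g g1 Hg t. eapply filterlim_comp; [apply Hgrid|].
      apply (ex_derive_continuous g). now exists (g1 t). }
    intros t. split.
    - apply (filterlim_Rle FU (fun n => al (grid (tau n) t)) (x t)); trivial.
      + intros n. apply (Hw n).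
      + now apply Hcont with al1.
    - apply (filterlim_Rle FU (x t) (fun n => be (grid (tau n) t))); trivial.
      + intros n. apply (Hw n).
      + now apply Hcont with be1. }
  intros t. apply (filterlim_Rle FU (fun n => Rabs (y t n)) (fun _ => V)); trivial.
  now apply (filterlim_Rabs_comp FU).
Qed.

End Existence.

(** * Periodic functions and compactness *)

Lemma periodic_INR {T : R} {g : R -> R} (n : nat) (t : R) :
  periodic T g -> g (t + INR n * T) = g t.
Proof.
  intros Hg. induction n as [|n IH].
  - simpl INR. f_equal. ring.
  - rewrite S_INR. replace (t + (INR n + 1) * T) with (t + INR n * T + T) by ring.
    rewrite (Hg (t + INR n * T)). exact IH.
Qed.

Lemma periodic_grid (T : R) (g : R -> R) (t : R) :
  periodic T g -> g (t - grid T t) = g t.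
Proof.
  intros Hg. unfold grid. set (z := Int_part (t / T)).
  destruct (Z_le_dec 0 z) as [Hz|Hz].
  - rewrite <- (periodic_INR (Z.to_nat z) (t - T * IZR z) Hg).
    rewrite INR_IZR_INZ, Z2Nat.id by lia. f_equal. ring.
  - rewrite <- (periodic_INR (Z.to_nat (- z)) t Hg).
    rewrite INR_IZR_INZ, Z2Nat.id, opp_IZR by lia. f_equal. ring.
Qed.

Lemma grid_remainder (T t : R) : 0 < T -> 0 <= t - grid T t <= T.
Proof.
  intros HT. unfold grid. destruct (base_Int_part (t / T)) as [H1 H2].
  set (z := IZR (Int_part (t / T))) in *.
  replace (t - T * z) with (T * (t / T - z)) by (field; lra). nra.
Qed.

(** Otherwise the points where [g] exceeds [n] would have an ultrafilter
    limit at which [g] is continuous, hence locally bounded. *)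
Lemma continuous3_box_bounded (g : R -> R -> R -> R) (a1 b1 a2 b2 a3 b3 : R) :
  continuous3 g -> exists M, forall x y z,
    a1 <= x <= b1 -> a2 <= y <= b2 -> a3 <= z <= b3 -> Rabs (g x y z) <= M.
Proof.
  intros Hg. apply NNPP. intros Hno.
  destruct (functional_choice (fun (n : nat) (s : R * R * R) =>
    a1 <= fst (fst s) <= b1 /\ a2 <= snd (fst s) <= b2 /\ a3 <= snd s <= b3 /\
    INR n < Rabs (g (fst (fst s)) (snd (fst s)) (snd s)))) as [s Hs].
  { intros n. apply NNPP. intros Hn. apply Hno. exists (INR n).
    intros x y z Hx Hy Hz. apply Rnot_lt_le. intros Hlt. apply Hn.
    now exists (x, y, z). }
  destruct free_ultrafilter_exists as [U [FU [HU Hev]]].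
  destruct (ultra_bounded_lim U FU HU (fun n => fst (fst (s n))) a1 b1) as [x Hx].
  { intros n. apply Hs. }
  destruct (ultra_bounded_lim U FU HU (fun n => snd (fst (s n))) a2 b2) as [y Hy].
  { intros n. apply Hs. }
  destruct (ultra_bounded_lim U FU HU (fun n => snd (s n)) a3 b3) as [z Hz].
  { intros n. apply Hs. }
  assert (Hlim : filterlim s U (locally (x, y, z))).
  { apply filterlim_locally. intros eps.
    assert (H1 := proj1 (filterlim_locally _ x) Hx eps).
    assert (H2 := proj1 (filterlim_locally _ y) Hy eps).
    assert (H3 := proj1 (filterlim_locally _ z) Hz eps).
    generalize (filter_and _ _ (filter_and _ _ H1 H2) H3). apply filter_imp.
    intros n [[K1 K2] K3]. repeat split; assumption. }
  assert (Hgl := filterlim_comp _ _ _ s _ _ _ _ Hlim (Hg (x, y, z))).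
  assert (H1 := proj1 (filterlim_locally _ _) Hgl (mkposreal 1 Rlt_0_1)).
  destruct (nfloor_ex (Rabs (g x y z) + 1)) as [m Hm].
  { assert (H := Rabs_pos (g x y z)). lra. }
  assert (H2 : U (fun n => (S m <= n)%nat)) by (apply Hev; now exists (S m)).
  destruct (filter_ex _ (filter_and _ _ H1 H2)) as [n [Hn1 Hn2]].
  destruct (Hs n) as [_ [_ [_ Hbig]]].
  change (Rabs (g (fst (fst (s n))) (snd (fst (s n))) (snd (s n)) - g x y z) < 1) in Hn1.
  apply le_INR in Hn2. rewrite S_INR in Hn2.
  set (w := g (fst (fst (s n))) (snd (fst (s n))) (snd (s n))) in *.
  assert (H := Rabs_triang_inv w (g x y z)). lra.
Qed.

Lemma continuous3_periodic_bounded (T : R) (g : R -> R -> R -> R)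
  (a1 b1 a2 b2 : R) :
  0 < T -> continuous3 g -> (forall x y, periodic T (fun z => g x y z)) ->
  exists M, 0 <= M /\ forall x y z,
    a1 <= x <= b1 -> a2 <= y <= b2 -> Rabs (g x y z) <= M.
Proof.
  intros HT Hg Hper.
  destruct (continuous3_box_bounded g a1 b1 a2 b2 0 T Hg) as [M HM].
  exists (Rabs M). split; [apply Rabs_pos|]. intros x y z Hx Hy.
  rewrite <- (periodic_grid T (fun z => g x y z) z (Hper x y)).
  apply Rle_trans with (2 := Rle_abs M). apply HM; trivial.
  now apply grid_remainder.
Qed.

Lemma continuous_periodic_bounded (T : R) (g : R -> R) :
  0 < T -> (forall t, continuous g t) -> periodic T g ->
  exists M, 0 <= M /\ forall t, Rabs (g t) <= M.
Proof.
  intros HT Hg Hper.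
  destruct (continuous3_periodic_bounded T (fun _ _ z => g z) 0 0 0 0 HT) as [M [HM0 HM]].
  - intros x. apply (continuous_comp (fun y : R * R * R => snd y) g).
    + apply continuous_snd.
    + apply Hg.
  - intros _ _. exact Hper.
  - exists M. split; trivial. intros t. apply (HM 0 0 t); lra.
Qed.

(** The inverse function is bounded. *)
Lemma periodic_positive_lower_bound (T : R) (g : R -> R) :
  0 < T -> (forall t, continuous g t) -> periodic T g -> (forall t, 0 < g t) ->
  exists eta, 0 < eta /\ forall t, eta <= g t.
Proof.
  intros HT Hg Hper Hpos.
  destruct (continuous_periodic_bounded T (fun t => / g t) HT) as [M [HM0 HM]].
  - intros t. apply continuous_Rinv_comp; [apply Hg|].
    apply Rgt_not_eq, Hpos.
  - intros t. now rewrite Hper.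
  - exists (/ (M + 1)). split; [apply Rinv_0_lt_compat; lra|].
    intros t. specialize (HM t). specialize (Hpos t).
    rewrite Rabs_pos_eq in HM by (left; now apply Rinv_0_lt_compat).
    rewrite <- (Rinv_inv (g t)).
    apply Rinv_le_contravar; [now apply Rinv_0_lt_compat | lra].
Qed.

Lemma periodic_derive (T : R) (g g' : R -> R) :
  (forall t, is_derive g t (g' t)) -> periodic T g -> periodic T g'.
Proof.
  intros Hd Hper t.
  rewrite <- (is_derive_unique _ _ _ (Hd t)).
  symmetry. apply is_derive_unique.
  apply is_derive_ext with (fun s => g (s + T)); [exact Hper|].
  replace (g' (t + T)) with (1 * g' (t + T)) by ring.
  apply (is_derive_comp g (fun s => s + T)); [apply Hd|].
  auto_derive; trivial.
Qed.

Lemma periodic_primitive (T : R) (g : R -> R) :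
  0 < T -> (forall t, continuous g t) -> periodic T g ->
  exists G, (forall t, is_derive G t (g t - / T * RInt g 0 T)) /\ periodic T G.
Proof.
  intros HT Hg Hper. set (m := / T * RInt g 0 T).
  assert (HG : forall t, is_derive (fun t => RInt g 0 t - t * m) t (g t - m)).
  { intros t. apply (is_derive_minus (fun t => RInt g 0 t) (fun t => t * m)).
    - apply (is_derive_RInt g (fun t => RInt g 0 t) 0 t); [|apply Hg].
      exists (mkposreal 1 Rlt_0_1). intros y _. apply (@RInt_correct R_CompleteNormedModule).
      apply (@ex_RInt_continuous R_CompleteNormedModule g). intros z _. apply Hg.
    - auto_derive; trivial. ring. }
  exists (fun t => RInt g 0 t - t * m). split; [exact HG|].
  intros t. apply Rminus_diag_uniq.
  assert (H0 : RInt g 0 (0 + T) - (0 + T) * m - (RInt g 0 0 - 0 * m) = 0).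
  { rewrite Rplus_0_l, RInt_point. unfold m, zero. simpl. field. lra. }
  set (D := fun t => RInt g 0 (t + T) - (t + T) * m - (RInt g 0 t - t * m)).
  assert (HD : Rabs (D t - D 0) <= 0 * Rabs (t - 0)).
  { apply (bounded_variation D (fun _ => 0)). intros s _.
    rewrite Rabs_R0. split; [|lra].
    replace 0 with (1 * (g (s + T) - m) - (g s - m)) by (rewrite (Hper s); ring).
    apply (is_derive_minus (fun t => RInt g 0 (t + T) - (t + T) * m)
      (fun t => RInt g 0 t - t * m)); [|apply HG].
    apply (is_derive_comp (fun t => RInt g 0 t - t * m) (fun s => s + T)); [apply HG|].
    auto_derive; trivial. }
  unfold D in HD at 2. rewrite H0, Rmult_0_l, Rminus_0_r in HD.
  assert (HD0 := Rabs_pos (D t)). destruct (Req_dec (D t) 0) as [He|He]; [exact He|].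
  apply Rabs_pos_lt in He. lra.
Qed.

(** * Local Lipschitz bound for the perturbation *)

Definition lipschitz_on_strip (h : R -> R -> R -> R) (lo hi P L : R) : Prop :=
  forall u p t u' p' t', lo <= u <= hi -> lo <= u' <= hi ->
    Rabs p <= P -> Rabs p' <= P ->
    Rabs (h u p t - h u' p' t')
    <= L * (Rabs (u - u') + Rabs (p - p') + Rabs (t - t')).

Lemma smooth3_lipschitz (T : R) (h : R -> R -> R -> R) (lo hi P : R) :
  0 < T -> smooth3 h -> (forall q p, periodic T (fun t => h q p t)) ->
  exists L, 0 <= L /\ lipschitz_on_strip h lo hi P L.
Proof.
  intros HT Hsm Hper.
  destruct (Hsm 1%nat) as [_ [Hex [[H1 _] [[H2 _] [H3 _]]]]].
  assert (E1 : forall x y z, is_derive (fun u => h u y z) x (D1 h x y z)).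
  { intros x y z. apply Derive_correct. destruct (Hex x y z) as [E _]. exact E. }
  assert (E2 : forall x y z, is_derive (fun u => h x u z) y (D2 h x y z)).
  { intros x y z. apply Derive_correct. destruct (Hex x y z) as [_ [E _]]. exact E. }
  assert (E3 : forall x y z, is_derive (fun u => h x y u) z (D3 h x y z)).
  { intros x y z. apply Derive_correct. destruct (Hex x y z) as [_ [_ E]]. exact E. }
  clear Hex.
  (* The mean value estimate below ranges over the ball around one point through
     the other, which can leave the strip: hence the larger box. *)
  set (a1 := lo - (hi - lo)). set (b1 := hi + (hi - lo)).
  destruct (continuous3_periodic_bounded T (D1 h) a1 b1 (- (3 * P)) (3 * P) HT H1)
    as [M1 [P1 B1]].
  { intros x y t. apply Derive_ext. intros u. apply Hper. }
  destruct (continuous3_periodic_bounded T (D2 h) a1 b1 (- (3 * P)) (3 * P) HT H2)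
    as [M2 [P2 B2]].
  { intros x y t. apply Derive_ext. intros u. apply Hper. }
  destruct (continuous3_periodic_bounded T (D3 h) a1 b1 (- (3 * P)) (3 * P) HT H3)
    as [M3 [P3 B3]].
  { intros x y. apply (periodic_derive T (fun t => h x y t)); [|apply Hper].
    intros t. apply E3. }
  exists (M1 + M2 + M3). split; [lra|].
  intros u p t u' p' t' Hu Hu' Hp Hp'.
  apply Rabs_le_between in Hp, Hp'.
  assert (V1 : Rabs (h u p t - h u' p t) <= M1 * Rabs (u - u')).
  { apply (bounded_variation (fun x => h x p t) (fun x => D1 h x p t)).
    intros x Hx. split; [apply E1|].
    apply B1; [|lra]. apply Rabs_le_between in Hx.
    assert (Rabs (u - u') <= hi - lo) by (apply Rabs_le; lra).
    unfold a1, b1. lra. }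
  assert (V2 : Rabs (h u' p t - h u' p' t) <= M2 * Rabs (p - p')).
  { apply (bounded_variation (fun x => h u' x t) (fun x => D2 h u' x t)).
    intros x Hx. split; [apply E2|].
    apply Rabs_le_between in Hx.
    assert (Rabs (p - p') <= 2 * P) by (apply Rabs_le; lra).
    apply B2; [unfold a1, b1|]; lra. }
  assert (V3 : Rabs (h u' p' t - h u' p' t') <= M3 * Rabs (t - t')).
  { apply (bounded_variation (fun x => h u' p' x) (fun x => D3 h u' p' x)).
    intros x _. split; [apply E3|].
    apply B3; [unfold a1, b1|]; lra. }
  replace (h u p t - h u' p' t')
    with ((h u p t - h u' p t) + (h u' p t - h u' p' t) + (h u' p' t - h u' p' t'))
    by ring.
  apply Rle_trans with (1 := Rabs_triang _ _).
  assert (V12 := Rabs_triang (h u p t - h u' p t) (h u' p t - h u' p' t)).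
  assert (Q1 := Rabs_pos (u - u')). assert (Q2 := Rabs_pos (p - p')).
  assert (Q3 := Rabs_pos (t - t')). nra.
Qed.

(** * Lower and upper solutions of the fast equation *)

Lemma sin_lipschitz (x y : R) : Rabs (sin x - sin y) <= Rabs (x - y).
Proof.
  rewrite <- (Rmult_1_l (Rabs (x - y))).
  apply (bounded_variation sin cos). intros t _. split.
  - apply is_derive_Reals, derivable_pt_lim_sin.
  - apply Rabs_le, COS_bound.
Qed.

Lemma sin_taylor1 (x y : R) :
  Rabs (sin x - sin y - cos y * (x - y)) <= (x - y) ^ 2.
Proof.
  replace (sin x - sin y - cos y * (x - y))
    with ((sin x - cos y * (x - y)) - (sin y - cos y * (y - y))) by ring.
  rewrite <- pow2_abs. simpl. rewrite Rmult_1_r.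
  apply (bounded_variation (fun z => sin z - cos y * (z - y)) (fun z => cos z - cos y)).
  intros z Hz. split.
  - auto_derive; trivial. ring.
  - apply Rle_trans with (2 := Hz). rewrite <- (Rmult_1_l (Rabs (z - y))).
    apply (bounded_variation cos (fun s => - sin s)). intros s _. split.
    + apply is_derive_Reals, derivable_pt_lim_cos.
    + rewrite Rabs_Ropp. apply Rabs_le, SIN_bound.
Qed.

Lemma continuous_of_is_derive (g g' : R -> R) :
  (forall t, is_derive g t (g' t)) -> forall t, continuous g t.
Proof.
  intros Hg t. apply (ex_derive_continuous g). now exists (g' t).
Qed.

Section Barrier.

Context (T mu Phi : R) (phi phi1 phi2 : R -> R).
Context (T_pos : 0 < T) (mu_nonneg : 0 <= mu)
  (phi_derive : forall t, is_derive phi t (phi1 t))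
  (phi1_derive : forall t, is_derive phi1 t (phi2 t))
  (phi2_cont : forall t, continuous phi2 t)
  (phi_per : periodic T phi)
  (phi_mean : RInt phi 0 T = 0)
  (Phi_eq : Phi = mean_square T phi).

(** A periodic second primitive exists because the right-hand side has zero mean:
    [phi' Psi + Phi] is the derivative of [phi Psi - E], where [E' = phi ^ 2 - Phi]
    and [E] is periodic by the choice of [Phi].  The mean of the first primitive
    is subtracted before integrating again. *)
Lemma corrector_exists (c1 c2 : R) :
  exists Psi chi chi1 : R -> R,
    (forall s, is_derive Psi s (phi s)) /\
    (forall s, is_derive chi s (chi1 s)) /\
    (forall s, is_derive chi1 s (c1 * (phi1 s * Psi s + Phi) + c2 * phi s)) /\
    periodic T Psi /\ periodic T chi /\ periodic T chi1.
Proof.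
  assert (Hphi := continuous_of_is_derive _ _ phi_derive).
  destruct (periodic_primitive T phi T_pos Hphi phi_per) as [Psi [HPsi PPsi]].
  rewrite phi_mean, Rmult_0_r in HPsi.
  assert (HPsi' : forall s, is_derive Psi s (phi s)).
  { intros s. replace (phi s) with (phi s - 0) by ring. apply HPsi. }
  destruct (periodic_primitive T (fun s => phi s ^ 2) T_pos) as [E [HE PE]].
  { intros s. apply (continuous_of_is_derive _ (fun s => 2 * phi s * phi1 s)).
    intros r. auto_derive; [now exists (phi1 r)|].
    replace (Derive (fun x => phi x) r) with (phi1 r)
      by (symmetry; now apply is_derive_unique). ring. }
  { intros s. now rewrite phi_per. }
  fold (mean_square T phi) in HE. rewrite <- Phi_eq in HE.
  set (H := fun s => c1 * (phi s * Psi s - E s) + c2 * Psi s).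
  assert (HH : forall s, is_derive H s (c1 * (phi1 s * Psi s + Phi) + c2 * phi s)).
  { intros s. unfold H. auto_derive.
    - repeat split; [now exists (phi1 s) | now exists (phi s)
        | now exists (phi s ^ 2 - Phi) | now exists (phi s)].
    - replace (Derive (fun x => phi x) s) with (phi1 s)
        by (symmetry; now apply is_derive_unique).
      replace (Derive (fun x => Psi x) s) with (phi s)
        by (symmetry; now apply is_derive_unique).
      replace (Derive (fun x => E x) s) with (phi s ^ 2 - Phi)
        by (symmetry; now apply is_derive_unique). ring. }
  assert (PH : periodic T H).
  { intros s. unfold H. now rewrite phi_per, PPsi, PE. }
  destruct (periodic_primitive T H T_pos (continuous_of_is_derive _ _ HH) PH)
    as [chi [Hchi Pchi]].
  exists Psi, chi, (fun s => H s - / T * RInt H 0 T).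
  split; [exact HPsi' | split; [exact Hchi | split; [|split; [|split]]]]; trivial.
  - intros s. set (c := / T * RInt H 0 T). set (d := c1 * _ + _).
    replace d with (d - 0) by ring.
    apply (is_derive_minus H (fun _ => c)); [apply HH | apply @is_derive_const].
  - intros s. now rewrite PH.
Qed.

Lemma periodic_fast {g : R -> R} (k : nat) (t : R) :
  periodic T g -> g (INR k * (t + T)) = g (INR k * t).
Proof.
  intros Hg. rewrite Rmult_plus_distr_l. now apply periodic_INR.
Qed.

(** The function behaves like the constant [a]: it stays close to [a], the
    momentum [g1 + phi (k t) sin g] stays close to 0, and what remains in the
    equation is the averaged force at [a]. *)
Lemma barrier_exists (a : R) :
  exists K : R, 0 <= K /\ forall k : nat, (0 < k)%nat ->
    exists g g1 g2 : R -> R,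
      (forall t, is_derive g t (g1 t)) /\ (forall t, is_derive g1 t (g2 t)) /\
      periodic T g /\
      (exists D, forall t, Rabs (g2 t) <= D) /\
      (exists L, forall s t, Rabs (g2 s - g2 t) <= L * Rabs (s - t)) /\
      (forall t, Rabs (g t - a) <= K / INR k) /\
      (forall t, Rabs (g1 t + phi (INR k * t) * sin (g t)) <= K / INR k) /\
      (forall t, Rabs (g2 t + mu * g1 t + sin (g t) * (1 + INR k * phi1 (INR k * t))
                       + f_avg Phi a) <= K / INR k).
Proof.
  assert (Hphi := continuous_of_is_derive _ _ phi_derive).
  assert (Hphi1 := continuous_of_is_derive _ _ phi1_derive).
  assert (Pphi1 := periodic_derive T _ _ phi_derive phi_per).
  assert (Pphi2 := periodic_derive T _ _ phi1_derive Pphi1).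
  set (sa := sin a). set (ca := cos a).
  destruct (corrector_exists (sa * ca) (mu * sa))
    as [Psi [chi [chi1 [HPsi [Hchi [Hchi1 [PPsi [Pchi Pchi1]]]]]]]].
  set (chi2 := fun s => sa * ca * (phi1 s * Psi s + Phi) + mu * sa * phi s) in Hchi1.
  change (forall s, is_derive chi1 s (chi2 s)) in Hchi1.
  set (chi3 := fun s => sa * ca * (phi2 s * Psi s + phi1 s * phi s) + mu * sa * phi1 s).
  assert (Hchi2 : forall s, is_derive chi2 s (chi3 s)).
  { intros s. unfold chi2, chi3. auto_derive.
    - repeat split; [now exists (phi2 s) | now exists (phi s) | now exists (phi1 s)].
    - replace (Derive (fun x => phi x) s) with (phi1 s)
        by (symmetry; now apply is_derive_unique).
      replace (Derive (fun x => Psi x) s) with (phi s)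
        by (symmetry; now apply is_derive_unique).
      replace (Derive (fun x => phi1 x) s) with (phi2 s)
        by (symmetry; now apply is_derive_unique). ring. }
  destruct (continuous_periodic_bounded T phi T_pos Hphi phi_per) as [M0 [N0 B0]].
  destruct (continuous_periodic_bounded T phi1 T_pos Hphi1 Pphi1) as [M1 [N1 B1]].
  destruct (continuous_periodic_bounded T phi2 T_pos phi2_cont Pphi2) as [M2 [N2 B2]].
  destruct (continuous_periodic_bounded T Psi T_pos
    (continuous_of_is_derive _ _ HPsi) PPsi) as [MP [NP BP]].
  destruct (continuous_periodic_bounded T chi T_pos
    (continuous_of_is_derive _ _ Hchi) Pchi) as [MX [NX BX]].
  destruct (continuous_periodic_bounded T chi1 T_pos
    (continuous_of_is_derive _ _ Hchi1) Pchi1) as [MX1 [NX1 BX1]].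
  assert (Pchi2 := periodic_derive T _ _ Hchi1 Pchi1).
  destruct (continuous_periodic_bounded T chi2 T_pos
    (continuous_of_is_derive _ _ Hchi2) Pchi2) as [MX2 [NX2 BX2]].
  assert (Pchi3 := periodic_derive T _ _ Hchi2 Pchi2).
  assert (Cchi3 : forall s, continuous chi3 s).
  { assert (Hc : forall f g : R -> R, (forall s, continuous f s) ->
      (forall s, continuous g s) -> forall s, continuous (fun s => f s * g s) s).
    { intros f g Hf Hg s. now apply (continuous_mult f g). }
    assert (Hp : forall f g : R -> R, (forall s, continuous f s) ->
      (forall s, continuous g s) -> forall s, continuous (fun s => f s + g s) s).
    { intros f g Hf Hg s. now apply (continuous_plus f g). }
    assert (Hk : forall c : R, forall s : R, continuous (fun _ : R => c) s).
    { intros c s. apply continuous_const. }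
    unfold chi3. apply Hp; [|now apply (Hc (fun _ => mu * sa))].
    apply (Hc (fun _ => sa * ca)); trivial. apply Hp; apply Hc; trivial.
    exact (continuous_of_is_derive _ _ HPsi). }
  destruct (continuous_periodic_bounded T chi3 T_pos Cchi3 Pchi3) as [MX3 [NX3 BX3]].
  assert (Bsa : Rabs sa <= 1) by (apply Rabs_le, SIN_bound).
  assert (Bca : Rabs ca <= 1) by (apply Rabs_le, COS_bound).
  set (A := MP + MX). assert (NA : 0 <= A) by (unfold A; lra).
  set (K := A + (MX1 + M0 * A) + (M1 * A ^ 2 + M1 * MX + mu * MX1 + A)).
  assert (Q1 : 0 <= M0 * A) by nra. assert (Q2 : 0 <= M1 * A ^ 2) by nra.
  assert (Q3 : 0 <= M1 * MX) by nra. assert (Q4 : 0 <= mu * MX1) by nra.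
  exists K. split; [unfold K; lra|]. intros k Hk.
  set (kk := INR k) in *.
  assert (Hk1 : 1 <= kk) by (apply (le_INR 1); lia).
  set (eps := / kk).
  assert (He0 : 0 < eps) by (apply Rinv_0_lt_compat; lra).
  assert (Hke : kk * eps = 1) by (apply Rinv_r; lra).
  assert (He1 : eps <= 1) by nra.
  set (g := fun t => a - eps * sa * Psi (kk * t) + eps ^ 2 * chi (kk * t)).
  set (g1 := fun t => - sa * phi (kk * t) + eps * chi1 (kk * t)).
  set (g2 := fun t => - (kk * sa) * phi1 (kk * t) + chi2 (kk * t)).
  assert (Hg : forall t, is_derive g t (g1 t)).
  { intros t. unfold g, g1. auto_derive.
    - repeat split; [now exists (phi (kk * t)) | now exists (chi1 (kk * t))].
    - replace (Derive (fun x => Psi x) (kk * t)) with (phi (kk * t))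
        by (symmetry; now apply is_derive_unique).
      replace (Derive (fun x => chi x) (kk * t)) with (chi1 (kk * t))
        by (symmetry; now apply is_derive_unique).
      unfold eps. field. lra. }
  assert (Hg1 : forall t, is_derive g1 t (g2 t)).
  { intros t. unfold g1, g2. auto_derive.
    - repeat split; [now exists (phi1 (kk * t)) | now exists (chi2 (kk * t))].
    - replace (Derive (fun x => phi x) (kk * t)) with (phi1 (kk * t))
        by (symmetry; now apply is_derive_unique).
      replace (Derive (fun x => chi1 x) (kk * t)) with (chi2 (kk * t))
        by (symmetry; now apply is_derive_unique).
      unfold eps. field. lra. }
  assert (Hg2 : forall t, is_derive g2 t
    (- (kk * sa) * (kk * phi2 (kk * t)) + kk * chi3 (kk * t))).
  { intros t. unfold g2. auto_derive.
    - repeat split; [now exists (phi2 (kk * t)) | now exists (chi3 (kk * t))].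
    - replace (Derive (fun x => phi1 x) (kk * t)) with (phi2 (kk * t))
        by (symmetry; now apply is_derive_unique).
      replace (Derive (fun x => chi2 x) (kk * t)) with (chi3 (kk * t))
        by (symmetry; now apply is_derive_unique).
      ring. }
  assert (Bks : Rabs (- (kk * sa)) <= kk).
  { rewrite Rabs_Ropp, Rabs_mult, (Rabs_pos_eq kk) by lra. nra. }
  assert (Hga : forall t, Rabs (g t - a) <= A * eps).
  { intros t. unfold g.
    replace (a - eps * sa * Psi (kk * t) + eps ^ 2 * chi (kk * t) - a)
      with (eps * (- (sa * Psi (kk * t)) + eps * chi (kk * t))) by ring.
    rewrite Rabs_mult, (Rabs_pos_eq eps), Rmult_comm by lra.
    apply Rmult_le_compat_r; [lra|].
    apply Rle_trans with (1 := Rabs_triang _ _).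
    rewrite Rabs_Ropp, !Rabs_mult, (Rabs_pos_eq eps) by lra.
    specialize (BP (kk * t)). specialize (BX (kk * t)).
    assert (Z1 := Rabs_pos (Psi (kk * t))). assert (Z2 := Rabs_pos (chi (kk * t))).
    unfold A. nra. }
  assert (Hsg : forall t, Rabs (sin (g t) - sa) <= A * eps).
  { intros t. apply Rle_trans with (2 := Hga t). apply sin_lipschitz. }
  exists g, g1, g2. split; [exact Hg | split; [exact Hg1 | split; [|split; [|split]]]].
  - intros t. unfold g. unfold kk.
    now rewrite (periodic_fast k t PPsi), (periodic_fast k t Pchi).
  - exists (kk * M1 + MX2). intros t. unfold g2.
    apply Rle_trans with (1 := Rabs_triang _ _).
    rewrite Rabs_mult. specialize (B1 (kk * t)). specialize (BX2 (kk * t)).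
    assert (Z := Rabs_pos (phi1 (kk * t))). nra.
  - exists (kk * (kk * M2) + kk * MX3). intros s t.
    apply (bounded_variation g2
      (fun t => - (kk * sa) * (kk * phi2 (kk * t)) + kk * chi3 (kk * t))).
    intros r _. split; [apply Hg2|].
    apply Rle_trans with (1 := Rabs_triang _ _).
    rewrite !(Rabs_mult _ (kk * _)), !(Rabs_mult kk), (Rabs_pos_eq kk) by lra.
    specialize (B2 (kk * r)). specialize (BX3 (kk * r)).
    assert (Z := Rabs_pos (phi2 (kk * r))).
    apply Rplus_le_compat; [|nra].
    apply Rmult_le_compat; [apply Rabs_pos | nra | exact Bks | nra].
  - change (K / kk) with (K * eps). split; [|split]; intros t.
    + apply Rle_trans with (1 := Hga t). apply Rmult_le_compat_r; unfold K; lra.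
    + replace (g1 t + phi (kk * t) * sin (g t))
        with (eps * chi1 (kk * t) + phi (kk * t) * (sin (g t) - sa))
        by (unfold g1; ring).
      apply Rle_trans with (1 := Rabs_triang _ _).
      rewrite !Rabs_mult, (Rabs_pos_eq eps) by lra.
      apply Rle_trans with (eps * MX1 + M0 * (A * eps)).
      * apply Rplus_le_compat; [apply Rmult_le_compat_l; [lra | apply BX1]|].
        apply Rmult_le_compat; [apply Rabs_pos | apply Rabs_pos | apply B0 | apply Hsg].
      * unfold K. nra.
    + set (R1 := sin (g t) - sa - ca * (g t - a)).
      assert (HR1 : Rabs R1 <= (A * eps) ^ 2).
      { apply Rle_trans with (1 := sin_taylor1 (g t) a).
        rewrite <- pow2_abs. apply pow_incr. split; [apply Rabs_pos | apply Hga]. }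
      replace (g2 t + mu * g1 t + sin (g t) * (1 + kk * phi1 (kk * t)) + f_avg Phi a)
        with (kk * (phi1 (kk * t) * R1) + eps * (phi1 (kk * t) * (ca * chi (kk * t)))
              + eps * (mu * chi1 (kk * t)) + (sin (g t) - sa)).
      * assert (X1 : Rabs (kk * (phi1 (kk * t) * R1)) <= M1 * A ^ 2 * eps).
        { rewrite !Rabs_mult, (Rabs_pos_eq kk) by lra.
          replace (M1 * A ^ 2 * eps) with (kk * (M1 * (A * eps) ^ 2))
            by (replace (kk * (M1 * (A * eps) ^ 2))
                  with (kk * eps * (M1 * A ^ 2 * eps)) by ring;
                rewrite Hke; ring).
          apply Rmult_le_compat_l; [lra|].
          apply Rmult_le_compat; [apply Rabs_pos | apply Rabs_pos | apply B1 | trivial]. }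
        assert (X2 : Rabs (eps * (phi1 (kk * t) * (ca * chi (kk * t)))) <= M1 * MX * eps).
        { rewrite !Rabs_mult, (Rabs_pos_eq eps) by lra.
          rewrite Rmult_comm. apply Rmult_le_compat_r; [lra|].
          assert (Z := Rabs_pos (chi (kk * t))). assert (Z' := Rabs_pos ca).
          specialize (BX (kk * t)).
          apply Rmult_le_compat; [apply Rabs_pos | nra | apply B1 | nra]. }
        assert (X3 : Rabs (eps * (mu * chi1 (kk * t))) <= mu * MX1 * eps).
        { rewrite !Rabs_mult, (Rabs_pos_eq eps), (Rabs_pos_eq mu) by lra.
          rewrite Rmult_comm. apply Rmult_le_compat_r; [lra|].
          apply Rmult_le_compat_l; [lra | apply BX1]. }
        specialize (Hsg t).
        apply Rabs_le_between in X1, X2, X3, Hsg.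
        assert (Q : K * eps = (A + MX1 + M0 * A) * eps + M1 * A ^ 2 * eps
          + M1 * MX * eps + mu * MX1 * eps + A * eps) by (unfold K; ring).
        assert (0 <= (A + MX1 + M0 * A) * eps) by (apply Rmult_le_pos; lra).
        apply Rabs_le. lra.
      * unfold f_avg. rewrite sin_2a. fold sa ca.
        unfold R1, g2, g1, chi2.
        assert (Hgt : g t - a = - eps * sa * Psi (kk * t) + eps ^ 2 * chi (kk * t))
          by (unfold g; ring).
        rewrite Hgt.
        assert (Hinv : kk = / eps) by (unfold eps; now rewrite Rinv_inv).
        set (x := phi1 (kk * t)). set (y := Psi (kk * t)). set (z := chi (kk * t)).
        set (p := phi (kk * t)). set (q := chi1 (kk * t)). set (s := sin (g t)).
        transitivity (kk * x * (s - sa) + kk * eps * (x * ca * sa * y)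
          - kk * eps * eps * (x * ca * z) + eps * (x * (ca * z)) + eps * (mu * q)
          + (s - sa)); [ring|].
        rewrite Hke. field.
Qed.

End Barrier.

(** * Periodic solutions of the fast system *)

Definition clamp (P x : R) : R := Rmax (- P) (Rmin P x).

Lemma clamp_bound (P x : R) : 0 <= P -> Rabs (clamp P x) <= P.
Proof.
  intros HP. unfold clamp, Rmax, Rmin. apply Rabs_le.
  destruct (Rle_dec P x); destruct (Rle_dec _ _); lra.
Qed.

Lemma clamp_id (P x : R) : Rabs x <= P -> clamp P x = x.
Proof.
  intros H. apply Rabs_le_between in H. unfold clamp.
  rewrite Rmin_right, Rmax_right; lra.
Qed.

Lemma clamp_lipschitz (P x y : R) :
  0 <= P -> Rabs (clamp P x - clamp P y) <= Rabs (x - y).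
Proof.
  intros HP. assert (H1 := Rle_abs (x - y)). assert (H2 := Rle_abs (- (x - y))).
  rewrite Rabs_Ropp in H2. assert (H3 := Rabs_pos (x - y)).
  unfold clamp, Rmax, Rmin. apply Rabs_le.
  destruct (Rle_dec P x); destruct (Rle_dec P y);
    repeat match goal with |- context [Rle_dec ?r ?s] => destruct (Rle_dec r s) end; lra.
Qed.

Lemma f_avg_lipschitz (Phi x y : R) :
  0 <= Phi -> Rabs (f_avg Phi x - f_avg Phi y) <= (1 + Phi) * Rabs (x - y).
Proof.
  intros HPhi. unfold f_avg.
  replace (- sin x - Phi / 2 * sin (2 * x) - (- sin y - Phi / 2 * sin (2 * y)))
    with (- (sin x - sin y) + - (Phi / 2 * (sin (2 * x) - sin (2 * y)))) by ring.
  apply Rle_trans with (1 := Rabs_triang _ _).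
  rewrite !Rabs_Ropp, Rabs_mult, (Rabs_pos_eq (Phi / 2)) by lra.
  assert (H1 := sin_lipschitz x y). assert (H2 := sin_lipschitz (2 * x) (2 * y)).
  replace (2 * x - 2 * y) with (2 * (x - y)) in H2 by ring.
  rewrite Rabs_mult, (Rabs_pos_eq 2) in H2 by lra. nra.
Qed.

(** In the variables [q] and [v = p - phi (k t) sin q] the system is a second
    order equation in which [phi ^ 2] has disappeared and [phi'] has appeared. *)
Lemma solution_of_second_order (mu : R) (phi phi1 : R -> R)
  (h : R -> R -> R -> R) (k : nat) (u v : R -> R) :
  (forall t, is_derive phi t (phi1 t)) ->
  (forall t, is_derive u t (v t)) ->
  (forall t, is_derive v t
     (- mu * v t + (- sin (u t) * (1 + INR k * phi1 (INR k * t))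
                    + h (u t) (v t + phi (INR k * t) * sin (u t)) t))) ->
  is_solution mu phi h k u (fun t => v t + phi (INR k * t) * sin (u t)).
Proof.
  intros Hphi Hu Hv t. split.
  - replace (v t + phi (INR k * t) * sin (u t) - phi (INR k * t) * sin (u t))
      with (v t) by ring. apply Hu.
  - set (F := h (u t) (v t + phi (INR k * t) * sin (u t)) t).
    auto_derive.
    + repeat split; [eexists; apply Hv | eexists; apply Hphi | eexists; apply Hu].
    + replace (Derive (fun x => u x) t) with (v t)
        by (symmetry; now apply is_derive_unique).
      replace (Derive (fun x => phi x) (INR k * t)) with (phi1 (INR k * t))
        by (symmetry; now apply is_derive_unique).
      replace (Derive (fun x => v x) t)
        with (- mu * v t + (- sin (u t) * (1 + INR k * phi1 (INR k * t)) + F))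
        by (symmetry; apply is_derive_unique, Hv).
      rewrite sin_2a. field.
Qed.

Section FastSystem.

Context (T mu Phi : R) (phi phi1 phi2 : R -> R) (h : R -> R -> R -> R).
Context (T_pos : 0 < T) (mu_nonneg : 0 <= mu) (Phi_nonneg : 0 <= Phi)
  (phi_derive : forall t, is_derive phi t (phi1 t))
  (phi1_derive : forall t, is_derive phi1 t (phi2 t))
  (phi2_cont : forall t, continuous phi2 t)
  (phi_per : periodic T phi)
  (phi_mean : RInt phi 0 T = 0)
  (Phi_eq : Phi = mean_square T phi)
  (h_bounded : bounded3 h) (h_smooth : smooth3 h)
  (h_per : forall q p, periodic T (fun t => h q p t)).

(** The clamp makes the force globally Lipschitz in the velocity without enlarging
    its supremum; at a level [P] above the velocity bound it is inactive on
    solutions. *)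
Definition regularized_force (k : nat) (P t u v : R) : R :=
  - sin u * (1 + INR k * phi1 (INR k * t))
  + h u (clamp P (v + phi (INR k * t) * sin u)) t.

Lemma regularized_force_lipschitz (k : nat) (P lo hi : R) :
  0 <= P -> exists L, 0 <= L /\ forall t u v t' u' v',
    lo <= u <= hi -> lo <= u' <= hi ->
    Rabs (regularized_force k P t u v - regularized_force k P t' u' v')
    <= L * (Rabs (t - t') + Rabs (u - u') + Rabs (v - v')).
Proof.
  intros HP.
  assert (Pphi1 := periodic_derive T _ _ phi_derive phi_per).
  assert (Pphi2 := periodic_derive T _ _ phi1_derive Pphi1).
  destruct (continuous_periodic_bounded T phi T_pos
    (continuous_of_is_derive _ _ phi_derive) phi_per) as [M0 [N0 B0]].
  destruct (continuous_periodic_bounded T phi1 T_pos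
    (continuous_of_is_derive _ _ phi1_derive) Pphi1) as [M1 [N1 B1]].
  destruct (continuous_periodic_bounded T phi2 T_pos phi2_cont Pphi2) as [M2 [N2 B2]].
  destruct (smooth3_lipschitz T h lo hi P T_pos h_smooth h_per) as [Lh [NL HL]].
  set (kk := INR k). assert (Hkk : 0 <= kk) by apply pos_INR.
  assert (K1 : 0 <= kk * M1) by nra. assert (K2 : 0 <= kk * (M2 * kk)) by nra.
  exists ((1 + kk * M1 + kk * (M2 * kk)) + Lh * (2 + M0 + kk * M1)).
  split; [nra|]. intros t u v t' u' v' Hu Hu'. unfold regularized_force. fold kk.
  set (dt := Rabs (t - t')). set (du := Rabs (u - u')). set (dv := Rabs (v - v')).
  assert (Zt : 0 <= dt) by apply Rabs_pos. assert (Zu : 0 <= du) by apply Rabs_pos.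
  assert (Zv : 0 <= dv) by apply Rabs_pos.
  assert (Bs : Rabs (sin u) <= 1) by (apply Rabs_le, SIN_bound).
  assert (Bs' : Rabs (sin u') <= 1) by (apply Rabs_le, SIN_bound).
  assert (Hs : Rabs (sin u - sin u') <= du) by apply sin_lipschitz.
  assert (Hkt : Rabs (kk * t - kk * t') = kk * dt).
  { replace (kk * t - kk * t') with (kk * (t - t')) by ring.
    now rewrite Rabs_mult, (Rabs_pos_eq kk). }
  assert (H0 : Rabs (phi (kk * t) - phi (kk * t')) <= M1 * (kk * dt)).
  { rewrite <- Hkt. apply (bounded_variation phi phi1). intros s _. now split. }
  assert (H1 : Rabs (phi1 (kk * t) - phi1 (kk * t')) <= M2 * (kk * dt)).
  { rewrite <- Hkt. apply (bounded_variation phi1 phi2). intros s _. now split. }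
  assert (Hfirst : Rabs (- sin u * (1 + kk * phi1 (kk * t))
       - - sin u' * (1 + kk * phi1 (kk * t')))
     <= (1 + kk * M1) * du + kk * (M2 * kk) * dt).
  { replace (- sin u * (1 + kk * phi1 (kk * t)) - - sin u' * (1 + kk * phi1 (kk * t')))
      with (- ((sin u - sin u') * (1 + kk * phi1 (kk * t)))
            + - (sin u' * (kk * (phi1 (kk * t) - phi1 (kk * t'))))) by ring.
    apply Rle_trans with (1 := Rabs_triang _ _).
    rewrite !Rabs_Ropp. apply Rplus_le_compat.
    - rewrite Rabs_mult, Rmult_comm.
      apply Rmult_le_compat; [apply Rabs_pos | apply Rabs_pos | | exact Hs].
      apply Rle_trans with (1 := Rabs_triang _ _).
      rewrite Rabs_R1, Rabs_mult, (Rabs_pos_eq kk) by trivial.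
      assert (H := B1 (kk * t)). nra.
    - rewrite !Rabs_mult, (Rabs_pos_eq kk) by trivial.
      assert (Z := Rabs_pos (phi1 (kk * t) - phi1 (kk * t'))).
      apply Rle_trans with (1 * (kk * (M2 * (kk * dt)))); [|right; ring].
      apply Rmult_le_compat; [apply Rabs_pos | nra | trivial | nra]. }
  set (w := v + phi (kk * t) * sin u). set (w' := v' + phi (kk * t') * sin u').
  assert (Hw : Rabs (w - w') <= dv + M0 * du + M1 * (kk * dt)).
  { unfold w, w'.
    replace (v + phi (kk * t) * sin u - (v' + phi (kk * t') * sin u'))
      with ((v - v') + phi (kk * t) * (sin u - sin u')
            + (phi (kk * t) - phi (kk * t')) * sin u') by ring.
    apply Rle_trans with (1 := Rabs_triang _ _). apply Rplus_le_compat.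
    - apply Rle_trans with (1 := Rabs_triang _ _). apply Rplus_le_compat_l.
      rewrite Rabs_mult. apply Rmult_le_compat; trivial; apply Rabs_pos.
    - rewrite Rabs_mult. rewrite <- (Rmult_1_r (M1 * (kk * dt))).
      apply Rmult_le_compat; trivial; apply Rabs_pos. }
  assert (Hc := clamp_lipschitz P w w' HP).
  assert (Hh := HL u (clamp P w) t u' (clamp P w') t' Hu Hu'
    (clamp_bound P w HP) (clamp_bound P w' HP)). fold du dt in Hh.
  assert (Hh' : Rabs (h u (clamp P w) t - h u' (clamp P w') t')
    <= Lh * (du + (dv + M0 * du + M1 * (kk * dt)) + dt)).
  { apply Rle_trans with (1 := Hh). apply Rmult_le_compat_l; lra. }
  replace (- sin u * (1 + kk * phi1 (kk * t)) + h u (clamp P w) t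
           - (- sin u' * (1 + kk * phi1 (kk * t')) + h u' (clamp P w') t'))
    with ((- sin u * (1 + kk * phi1 (kk * t)) - - sin u' * (1 + kk * phi1 (kk * t')))
          + (h u (clamp P w) t - h u' (clamp P w') t')) by ring.
  apply Rle_trans with (1 := Rabs_triang _ _).
  apply Rle_trans with (1 := Rplus_le_compat _ _ _ _ Hfirst Hh').
  rewrite (Rmult_plus_distr_r _ (Lh * _) (dt + du + dv)). apply Rplus_le_compat.
  - assert (0 <= (1 + kk * M1) * (dt + dv)) by nra.
    assert (0 <= kk * (M2 * kk) * (du + dv)) by nra. lra.
  - rewrite Rmult_assoc. apply Rmult_le_compat_l; trivial.
    assert (0 <= M0 * dt) by nra. assert (0 <= M0 * dv) by nra.
    assert (0 <= kk * M1 * du) by nra. assert (0 <= kk * M1 * dv) by nra. lra.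
Qed.

(** The bound does not depend on the clamping level [P], so that [P] can be chosen
    after it. *)
Lemma regularized_force_bound :
  exists C : nat -> R, forall k P t u v, Rabs (regularized_force k P t u v) <= C k.
Proof.
  destruct h_bounded as [M HM].
  destruct (continuous_periodic_bounded T phi1 T_pos
    (continuous_of_is_derive _ _ phi1_derive)
    (periodic_derive T _ _ phi_derive phi_per)) as [M1 [N1 B1]].
  exists (fun k => 1 + INR k * M1 + M). intros k P t u v.
  unfold regularized_force.
  apply Rle_trans with (1 := Rabs_triang _ _). apply Rplus_le_compat; [|apply HM].
  assert (Hk := pos_INR k).
  rewrite Rabs_mult, Rabs_Ropp, <- (Rmult_1_l (1 + INR k * M1)).
  apply Rmult_le_compat; [apply Rabs_pos | apply Rabs_pos | apply Rabs_le, SIN_bound |].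
  apply Rle_trans with (1 := Rabs_triang _ _).
  rewrite Rabs_R1, Rabs_mult, (Rabs_pos_eq (INR k)) by trivial.
  assert (H := B1 (INR k * t)). nra.
Qed.

Lemma regularized_force_periodic (k : nat) (P u v : R) :
  periodic T (fun t => regularized_force k P t u v).
Proof.
  assert (Pphi1 := periodic_derive T _ _ phi_derive phi_per).
  intros t. unfold regularized_force.
  rewrite (periodic_fast T k t phi_per), (periodic_fast T k t Pphi1).
  f_equal. apply h_per.
Qed.

(** The sign [sigma] lets the same statement serve both ends of the interval. *)
Lemma strict_margin (a sigma : R) :
  (forall t, 0 < sigma * (f_avg Phi a + h a 0 t)) ->
  exists eta, 0 < eta /\ forall t, eta <= sigma * (f_avg Phi a + h a 0 t).
Proof.
  intros Hpos. apply (periodic_positive_lower_bound T); trivial.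
  - intros t. destruct (h_smooth 1%nat) as [_ [Hex _]].
    destruct (Hex a 0 t) as [_ [_ E]].
    apply (continuous_scal_r sigma (fun t => f_avg Phi a + h a 0 t)).
    apply (continuous_plus (fun _ => f_avg Phi a)); [apply continuous_const|].
    now apply (ex_derive_continuous (fun t => h a 0 t)).
  - intros t. f_equal. f_equal. apply h_per.
Qed.

Theorem periodic_solution_in_interval (a b : R) :
  a < b ->
  (forall t, f_avg Phi a + h a 0 t < 0) ->
  (forall t, 0 < f_avg Phi b + h b 0 t) ->
  exists K : nat, forall k : nat, (K < k)%nat ->
    exists q p, is_periodic_solution T mu phi h k q p /\
      (forall t, a < q t < b).
Proof.
  intros Hab Ha Hb.
  destruct (strict_margin a (-1)) as [eta1 [Heta1 Hma]].
  { intros t. specialize (Ha t). lra. }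
  destruct (strict_margin b 1) as [eta2 [Heta2 Hmb]].
  { intros t. specialize (Hb t). lra. }
  set (eta := Rmin eta1 eta2).
  assert (Heta : 0 < eta) by now apply Rmin_glb_lt.
  assert (Ee1 : eta <= eta1) by apply Rmin_l.
  assert (Ee2 : eta <= eta2) by apply Rmin_r.
  destruct (smooth3_lipschitz T h a b 1 T_pos h_smooth h_per) as [Lh [NL HL]].
  set (W := 1 + Phi + 3 * Lh + 1).
  assert (HW : 0 < W) by (unfold W; lra).
  (* The barriers are centred at distance [delta] from the ends of the interval
     and deviate by at most [delta / 2].  The three bounds on [delta] keep them
     ordered, keep the momentum in the range where [Lh] is valid, and keep the
     perturbation of the averaged force below half of its margin. *)
  set (delta := Rmin (Rmin ((b - a) / 3) 1) (eta / (2 * W))).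
  assert (Hew : 0 < eta / (2 * W)) by (apply Rdiv_lt_0_compat; lra).
  assert (Hdelta : 0 < delta).
  { apply Rmin_glb_lt; [apply Rmin_glb_lt; lra | exact Hew]. }
  assert (Hd1 : delta <= (b - a) / 3)
    by (apply Rle_trans with (1 := Rmin_l _ _), Rmin_l).
  assert (Hd2 : delta <= 1)
    by (apply Rle_trans with (1 := Rmin_l _ _), Rmin_r).
  assert (Hd3 : W * delta <= eta / 2).
  { apply Rle_trans with (W * (eta / (2 * W))); [|right; field; lra].
    apply Rmult_le_compat_l; [lra | apply Rmin_r]. }
  destruct (barrier_exists T mu Phi phi phi1 phi2 T_pos mu_nonneg phi_derive
    phi1_derive phi2_cont phi_per phi_mean Phi_eq (a + delta)) as [Ka [NKa Hbar_a]].
  destruct (barrier_exists T mu Phi phi phi1 phi2 T_pos mu_nonneg phi_derive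
    phi1_derive phi2_cont phi_per phi_mean Phi_eq (b - delta)) as [Kb [NKb Hbar_b]].
  destruct regularized_force_bound as [C HC].
  destruct (continuous_periodic_bounded T phi T_pos
    (continuous_of_is_derive _ _ phi_derive) phi_per) as [M0 [N0 B0]].
  destruct (nfloor_ex (2 * (Ka + Kb) / delta)) as [K0 HK0].
  { apply Rmult_le_pos; [lra | left; now apply Rinv_0_lt_compat]. }
  exists K0. intros k Hk.
  assert (Hkp : (0 < k)%nat) by lia.
  assert (Hkr : 0 < INR k) by now apply lt_0_INR.
  assert (HKd : (Ka + Kb) / INR k <= delta / 2).
  { apply (le_INR (S K0)) in Hk. rewrite S_INR in Hk.
    assert (H : 2 * (Ka + Kb) / delta <= INR k) by lra.
    apply Rmult_le_compat_r with (r := delta) in H; [|lra].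
    replace (2 * (Ka + Kb) / delta * delta) with (2 * (Ka + Kb)) in H by (field; lra).
    apply Rmult_le_reg_r with (INR k); trivial.
    replace ((Ka + Kb) / INR k * INR k) with (Ka + Kb) by (field; lra). lra. }
  assert (HKad : Ka / INR k <= delta / 2).
  { apply Rle_trans with (2 := HKd). apply Rmult_le_compat_r; [|lra].
    left. now apply Rinv_0_lt_compat. }
  assert (HKbd : Kb / INR k <= delta / 2).
  { apply Rle_trans with (2 := HKd). apply Rmult_le_compat_r; [|lra].
    left. now apply Rinv_0_lt_compat. }
  destruct (Hbar_a k Hkp) as [al [al1 [al2 [Al1 [Al2 [Al3 [[Da Al4] [[La Al5] [Al6 [Al7 Al8]]]]]]]]]].
  destruct (Hbar_b k Hkp) as [be [be1 [be2 [Be1 [Be2 [Be3 [[Db Be4] [[Lb Be5] [Be6 [Be7 Be8]]]]]]]]]].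
  assert (Ral : forall t, a + delta / 2 <= al t <= a + 3 * delta / 2).
  { intros t. specialize (Al6 t). apply Rabs_le_between in Al6. lra. }
  assert (Rbe : forall t, b - 3 * delta / 2 <= be t <= b - delta / 2).
  { intros t. specialize (Be6 t). apply Rabs_le_between in Be6. lra. }
  set (V := mu * (b - a) + C k * T).
  assert (HCk : 0 <= C k)
    by (apply Rle_trans with (2 := HC k 0 0 0 0); apply Rabs_pos).
  assert (HV : 0 <= V) by (unfold V; nra).
  (* [V] bounds the velocity of the solution, so [P] bounds its momentum; the
     extra 1 covers the momentum of the barriers. *)
  set (P := V + M0 + 1).
  assert (HP : 0 <= P) by (unfold P; lra).
  destruct (regularized_force_lipschitz k P a b HP) as [L [NLr HLr]].
  assert (Hh_near : forall c q w t, a <= c <= b -> a <= q <= b -> Rabs (q - c) <= 2 * delta ->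
    Rabs w <= delta -> Rabs (h q w t - h c 0 t) <= 3 * Lh * delta).
  { intros c q w t Hc Hq Hqc Hw.
    apply Rle_trans with (Lh * (Rabs (q - c) + Rabs (w - 0) + Rabs (t - t))).
    - apply HL; trivial; [lra | rewrite Rabs_R0; lra].
    - rewrite Rminus_0_r, Rminus_diag, Rabs_R0.
      replace (3 * Lh * delta) with (Lh * (2 * delta + delta + 0)) by ring.
      apply Rmult_le_compat_l; lra. }
  assert (Hf_near : forall c q, Rabs (q - c) <= delta ->
    Rabs (f_avg Phi q - f_avg Phi c) <= (1 + Phi) * delta).
  { intros c q Hqc. apply Rle_trans with (1 := f_avg_lipschitz Phi q c Phi_nonneg).
    apply Rmult_le_compat_l; lra. }
  assert (HWd : W * delta = (1 + Phi) * delta + 3 * Lh * delta + delta)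
    by (unfold W; ring).
  assert (Hlow : forall t, eta / 2 <= al2 t - force mu (regularized_force k P) t (al t) (al1 t)).
  { intros t. unfold force, regularized_force.
    specialize (Al7 t). specialize (Al8 t). specialize (Ral t). specialize (Hma t).
    rewrite clamp_id by (unfold P; lra).
    assert (H1 := Hh_near a (al t) (al1 t + phi (INR k * t) * sin (al t)) t
      ltac:(lra) ltac:(lra) ltac:(apply Rabs_le; lra) ltac:(lra)).
    assert (H2 := Hf_near a (a + delta) ltac:(apply Rabs_le; lra)).
    apply Rabs_le_between in H1, H2, Al8. lra. }
  assert (Hup : forall t, be2 t - force mu (regularized_force k P) t (be t) (be1 t) <= - (eta / 2)).
  { intros t. unfold force, regularized_force.
    specialize (Be7 t). specialize (Be8 t). specialize (Rbe t). specialize (Hmb t).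
    rewrite clamp_id by (unfold P; lra).
    assert (H1 := Hh_near b (be t) (be1 t + phi (INR k * t) * sin (be t)) t
      ltac:(lra) ltac:(lra) ltac:(apply Rabs_le; lra) ltac:(lra)).
    assert (H2 := Hf_near b (b - delta) ltac:(apply Rabs_le; lra)).
    apply Rabs_le_between in H1, H2, Be8. lra. }
  destruct (periodic_solution_between T mu (C k) L (Rmax La Lb) (Rmax Da Db) a b (eta / 2)
    (regularized_force k P) al al1 al2 be be1 be2)
    as [u [v [Hu [Hv [Pu [Pv [Ruv Bv]]]]]]]; trivial; try lra.
  - apply regularized_force_periodic.
  - intros t. specialize (Ral t). lra.
  - intros t. specialize (Ral t). specialize (Rbe t). lra.
  - intros t. specialize (Rbe t). lra.
  - intros s t. apply Rle_trans with (1 := Al5 s t).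
    apply Rmult_le_compat_r; [apply Rabs_pos | apply Rmax_l].
  - intros t. apply Rle_trans with (1 := Al4 t). apply Rmax_l.
  - intros s t. apply Rle_trans with (1 := Be5 s t).
    apply Rmult_le_compat_r; [apply Rabs_pos | apply Rmax_r].
  - intros t. apply Rle_trans with (1 := Be4 t). apply Rmax_r.
  - exists u, (fun t => v t + phi (INR k * t) * sin (u t)).
    split; [split; [|split]|].
    + apply (solution_of_second_order mu phi phi1); trivial.
      intros t. specialize (Hv t). unfold regularized_force in Hv.
      rewrite clamp_id in Hv; trivial.
      apply Rle_trans with (1 := Rabs_triang _ _).
      rewrite Rabs_mult. specialize (Bv t). fold V in Bv.
      assert (H1 := B0 (INR k * t)). assert (H0 := Rabs_pos (phi (INR k * t))).
      assert (H2 : Rabs (sin (u t)) <= 1) by (apply Rabs_le, SIN_bound).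
      unfold P. nra.
    + exact Pu.
    + intros t. now rewrite (periodic_fast T k t phi_per), (Pu t), (Pv t).
    + intros t. specialize (Ruv t). specialize (Ral t). specialize (Rbe t). lra.
Qed.

End FastSystem.

Lemma f_avg_PI2 (Phi : R) : f_avg Phi (PI / 2) = -1.
Proof.
  unfold f_avg. replace (2 * (PI / 2)) with PI by field.
  rewrite sin_PI2, sin_PI. ring.
Qed.

Lemma f_avg_3PI2 (Phi : R) : f_avg Phi (3 * PI / 2) = 1.
Proof.
  unfold f_avg. replace (2 * (3 * PI / 2)) with (PI + 2 * INR 1 * PI) by (simpl; field).
  rewrite sin_period, sin_PI.
  replace (3 * PI / 2) with (PI / 2 + PI) by field.
  rewrite neg_sin, sin_PI2. ring.
Qed.

Lemma PI2_lt_qmax2 (Phi : R) : 0 < Phi -> PI / 2 < qmax2 Phi.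
Proof.
  intros HPhi. unfold qmax2.
  assert (Hl : lambda2 Phi < 0).
  { unfold lambda2. assert (H := sqrt_pos (1 + 8 * Phi ^ 2)).
    apply Rmult_lt_reg_r with (4 * Phi); [lra|].
    replace ((-1 - sqrt (1 + 8 * Phi ^ 2)) / (4 * Phi) * (4 * Phi))
      with (-1 - sqrt (1 + 8 * Phi ^ 2)) by (field; lra). lra. }
  assert (HP := PI_RGT_0).
  destruct (Rle_dec (-1) (lambda2 Phi)) as [H|H].
  - apply Rnot_le_lt. intros Hle.
    assert (Hc := cos_ge_0 (acos (lambda2 Phi))).
    rewrite cos_acos in Hc by lra. destruct (acos_bound (lambda2 Phi)). lra.
  - (* [acos] is constantly [PI] to the left of -1. *)
    unfold acos. destruct (Rle_dec (lambda2 Phi) (-1)); lra.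
Qed.

Theorem theorem2p2 (T mu : R) (phi : R -> R) (h : R -> R -> R -> R)
  (hT : 0 < T) (hmu : 0 <= mu)
  (hphi_smooth : smooth1 phi)
  (hphi_per : periodic T phi)
  (hphi_mean : RInt phi 0 T = 0)
  (hh_bounded : bounded3 h)
  (hh_smooth : smooth3 h)
  (hh_per : forall q p, periodic T (fun t => h q p t))
  (Phi : R) (hPhi : Phi = mean_square T phi)
  (hPhi1 : 1 < Phi)
  (hh_bounds : forall t : R,
     h (PI / 2) 0 t < 1 /\
     h (3 * PI / 2) 0 t > -1 /\
     h (qmax2 Phi) 0 t > - f_avg Phi (qmax2 Phi) /\
     h (qmin2 Phi) 0 t < - f_avg Phi (qmin2 Phi)) :
  exists K : nat, forall k : nat, (K < k)%nat ->
    exists q1 p1 q2 p2 : R -> R,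
      is_periodic_solution T mu phi h k q1 p1 /\
      is_periodic_solution T mu phi h k q2 p2 /\
      (forall t : R, PI / 2 < q1 t < qmax2 Phi) /\
      (forall t : R, qmin2 Phi < q2 t < 3 * PI / 2).
Proof.
  assert (D1 : forall t, is_derive phi t (Derive_n phi 1 t)).
  { intros t. apply Derive_correct, (hphi_smooth 1%nat t). }
  assert (D2 : forall t, is_derive (Derive_n phi 1) t (Derive_n phi 2 t)).
  { intros t. apply Derive_correct, (hphi_smooth 2%nat t). }
  assert (D3 : forall t, continuous (Derive_n phi 2) t).
  { intros t. apply (ex_derive_continuous (Derive_n phi 2)), (hphi_smooth 3%nat t). }
  assert (Hq := PI2_lt_qmax2 Phi ltac:(lra)).
  assert (Hsol := periodic_solution_in_interval T mu Phi phi _ _ h hT hmu ltac:(lra)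
    D1 D2 D3 hphi_per hphi_mean hPhi hh_bounded hh_smooth hh_per).
  destruct (Hsol (PI / 2) (qmax2 Phi)) as [K1 HK1]; trivial.
  { intros t. rewrite f_avg_PI2. destruct (hh_bounds t) as [H _]. lra. }
  { intros t. destruct (hh_bounds t) as [_ [_ [H _]]]. lra. }
  destruct (Hsol (qmin2 Phi) (3 * PI / 2)) as [K2 HK2].
  { unfold qmin2. fold (qmax2 Phi). lra. }
  { intros t. destruct (hh_bounds t) as [_ [_ [_ H]]]. lra. }
  { intros t. rewrite f_avg_3PI2. destruct (hh_bounds t) as [_ [H _]]. lra. }
  exists (K1 + K2)%nat. intros k Hk.
  destruct (HK1 k ltac:(lia)) as [q1 [p1 [S1 R1]]].
  destruct (HK2 k ltac:(lia)) as [q2 [p2 [S2 R2]]].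
  exists q1, p1, q2, p2. exact (conj S1 (conj S2 (conj R1 R2))).
Qed.
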